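(* Let $\widetilde{G}$ be a connected mixed graph. Then $p^{+}(\widetilde{G})= m(\widetilde{G})+c(\widetilde{G})$ if and only if the following three conditions all hold: (i) any two cycles of $\widetilde{G}$ share no common vertices; (ii) for each cycle $\widetilde{C_{q}}$ of $\widetilde{G}$ (with $q$ vertices), $q$ is odd, $\sigma(\widetilde{C_{q}})$ is even and $|\sigma(\widetilde{C_{q}})-q| \equiv 1 \pmod 4$; (iii) there exists a maximum matching $M(\widetilde{G})$ of $\widetilde{G}$ such that $M(\widetilde{G}) \cap \mathscr{F}(\widetilde{G}) =\emptyset$.
   Context: All graphs are finite, without loops or multiple edges. A mixed graph $\widetilde{G}$ is obtained from an undirected graph $G$ (its underlying graph) by orienting some of the edges of $G$; cycles, matchings and connectedness of $\widetilde{G}$ refer to $G$. If $\widetilde{G}$ has vertices $v_1,\dots,v_n$, its Hermitian adjacency matrix is the $n\times n$ matrix $H(\widetilde{G})=(h_{kl})$ with $h_{kl}=-h_{lk}=\mathbf{i}$ (the imaginary unit) if there is an arc from $v_k$ to $v_l$, $h_{kl}=h_{lk}=1$ if $v_k,v_l$ are joined by an undirected edge, and $h_{kl}=0$ otherwise. $H(\widetilde{G})$ is Hermitian; $p^{+}(\widetilde{G})$ denotes the number of positive eigenvalues of $H(\widetilde{G})$ (with multiplicity). The matching number $m(\widetilde{G})$ is the maximum cardinality of a matching; a maximum matching is a matching of that cardinality. $c(\widetilde{G})=|E(G)|-|V(G)|+\omega(G)$, where $\omega(G)$ is the number of connected components of $G$. The signature of a mixed cycle $\widetilde{C}$ is $\sigma(\widetilde{C})=|f-b|$,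 where $f$ and $b$ are the numbers of forward-oriented and backward-oriented arcs of $\widetilde{C}$ with respect to a traversal of the cycle (undirected edges are not counted). When any two distinct cycles of $\widetilde{G}$ are vertex disjoint, $\mathscr{F}(\widetilde{G})$ denotes the set of edges of $\widetilde{G}$ that have one endpoint on a cycle and the other endpoint outside that cycle (so $\mathscr{F}(\widetilde{G})=\emptyset$ if $\widetilde{G}$ is a tree or a cycle). *)

(* Defs.v *)
From mathcomp Require Import all_boot all_order all_algebra.

Set Implicit Arguments.
Unset Strict Implicit.
Unset Printing Implicit Defensive.

Import Order.TTheory GRing.Theory Num.Theory.

Local Open Scope ring_scope.

(* [adj] is the underlying simple graph; [arc x y] says that the edge xy has
   been oriented from x to y.  Edges with no arc remain undirected. *)
Record mixedGraph (T : finType) := MixedGraph {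
  adj : rel T;
  arc : rel T;
  adj_sym : symmetric adj;
  adj_irr : irreflexive adj;
  arc_adj : forall x y, arc x y -> adj x y;
  arc_asym : forall x y, arc x y -> ~~ arc y x
}.

Section MixedGraph.
Variables (T : finType) (G : mixedGraph T).

Definition edges : {set {set T}} :=
  [set [set p.1; p.2] | p : T * T & adj G p.1 p.2].

Definition ncomponents : nat := n_comp (adj G) T.

(* The graph with no vertex has no component, so it is not connected. *)
Definition connected_graph : Prop := ncomponents = 1%N.

Definition cyclomatic : int :=
  #|edges|%:Z - #|T|%:Z + ncomponents%:Z.

Definition matching (M : {set {set T}}) : bool :=
  (M \subset edges) && trivIset M.

Definition matching_number : nat :=
  (\max_(M : {set {set T}} | matching M) #|M|)%N.

Definition maximum_matching (M : {set {set T}}) : bool :=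
  matching M && (#|M| == matching_number).

(* A cycle is given by the list of its vertices along a traversal.  Lists that
   differ by a rotation or a reversal describe the same cycle, so cycles are
   to be compared through [cycle_edges]. *)
Definition is_cycle (c : seq T) : bool :=
  [&& (2 < size c)%N, uniq c & cycle (adj G) c].

Definition cycle_edges (c : seq T) : {set {set T}} :=
  [set [set x; next c x] | x in c].

Definition cycles_disjoint : Prop :=
  forall c1 c2 : seq T, is_cycle c1 -> is_cycle c2 ->
    cycle_edges c1 != cycle_edges c2 -> forall x, x \in c1 -> x \notin c2.

Definition forward_arcs (c : seq T) : nat :=
  count (fun x => arc G x (next c x)) c.

Definition backward_arcs (c : seq T) : nat :=
  count (fun x => arc G (next c x) x) c.

Definition signature (c : seq T) : nat :=
  absz ((forward_arcs c)%:Z - (backward_arcs c)%:Z).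

(* Membership in the set F(G). *)
Definition leaves_cycle (e : {set T}) : Prop :=
  exists (c : seq T) (x y : T),
    [/\ is_cycle c, x \in c, y \notin c, adj G x y & e = [set x; y]].

Variable C : numClosedFieldType.

Definition hentry (x y : T) : C :=
  if arc G x y then 'i
  else if arc G y x then - 'i
  else if adj G x y then 1 else 0.

(* The vertices are numbered by the canonical enumeration of [T]. *)
Definition hermitian_adjacency : 'M[C]_#|T| :=
  \matrix_(k, l) hentry (enum_val k) (enum_val l).

End MixedGraph.

(* The roots of the characteristic polynomial, repeated according to their
   multiplicity. *)
Definition eigenvalues (C : numClosedFieldType) (n : nat) (A : 'M[C]_n) :
  seq C := sval (closed_field_poly_normal (char_poly A)).

(* In a [numClosedFieldType], [0 < z] entails that z is real. *)
Definition pos_inertia (T : finType) (G : mixedGraph T)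
    (C : numClosedFieldType) : nat :=
  count (fun z => 0 < z) (eigenvalues (hermitian_adjacency G C)).

(* Main.v *)
Require Import Defs.
From mathcomp Require Import all_boot all_order all_algebra.
From mathcomp Require Import zify.

Set Implicit Arguments.
Unset Strict Implicit.
Unset Printing Implicit Defensive.

Import Order.TTheory GRing.Theory Num.Theory.

Local Open Scope ring_scope.

(* For every mixed graph p+ <= m + c, by induction on the number of edges:
   isolating a vertex lowers p+ by at most 1; on a cycle it also lowers c, and
   at the neighbour of a pendant vertex of a forest it lowers m.  A vertex at
   which two cycles diverge lowers c by 2, so equality forces (i), and then
   equality passes to G - a, with the same m, for every vertex a on a cycle.
   Max matchings avoiding F of all the G - a, for a on one cycle K, are glued
   along the components of G - E(K) into one matching as in (iii) that still
   misses a prescribed vertex of K; hence K is odd.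
   The cycle condition (ii) is a sign.  If p+ and p- of G - E(K) do not change
   when the vertices of K are isolated, then neither does the rank, and the
   kernel equation on the odd cycle K extends to a vector z with z_x = 1 and
   z H = l e_x, where l = (-1)^((q-1)/2) 2 Re(w) and w is the product of the
   entries of H along K.  So p+ drops when x is isolated iff l > 0, that is,
   iff (ii) holds for K.  The converse runs the same step while keeping track
   of p+ = m + c and p- = m together. *)

(** * Positive inertia of Hermitian matrices *)

(** Extremality controls p+ only, whereas the kernel step needs the rank, hence p- too. For (ii) the
    way out lies in choosing when a cycle is tested. If G - E(K) has a cycle K', then K' misses K by
    (i), and (ii) for K comes by induction from G - y with y on K'. Otherwise G - E(K), and what
    remains of it when K is isolated, are forests, where the converse gives p+ = p- = m; so the
    converse is proved first. It carries p- = m along because its own kernel step meets the same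
    obstacle. Gluing is forced because K is not a cycle of G - a: a matching avoiding F(G - a) may
    still use edges that leave K at other vertices. Of each such matching only the part in the
    component of a in G - E(K) is used, and there it misses a. The sign of l decides because z H = l
    e_x makes z orthogonal to all vectors vanishing at x: the form splits into its restriction to
    these vectors plus l |.|^2. *)

Section PositiveInertia.

Variable C : numClosedFieldType.
Local Notation "M ^t*" := (map_mx Num.conj M^T) (at level 30).

Definition npos n (A : 'M[C]_n) : nat := count (fun z => 0 < z) (eigenvalues A).

(** Conjugation preserves the characteristic polynomial, and a product of factors X - z determines
    the z up to order. *)
Lemma eigenvalues_similar n (A P : 'M[C]_n) (d : 'rV_n) :
  P \in unitmx -> A = invmx P *m diag_mx d *m P ->
  perm_eq (eigenvalues A) [seq d 0 i | i : 'I_n].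
Proof.
move=> Pu eA; rewrite /eigenvalues.
case: closed_field_poly_normal => s /= es.
have: char_poly A = \prod_(z <- [seq d 0 i | i : 'I_n]) ('X - z%:P).
  rewrite eA; set B := diag_mx d.
  have -> : char_poly (invmx P *m B *m P) = char_poly B.
    rewrite /char_poly /char_poly_mx !map_mxM /=.
    have PI : map_mx polyC (invmx P) *m map_mx polyC P = 1%:M.
      by rewrite -map_mxM mulVmx // map_mx1.
    have -> : 'X%:M - map_mx polyC (invmx P) *m map_mx polyC B *m map_mx polyC P =
       map_mx polyC (invmx P) *m ('X%:M - map_mx polyC B) *m map_mx polyC P.
      by rewrite mulmxBr mulmxBl scalar_mxC -!mulmxA PI mulmx1.
    by rewrite !det_mulmx mulrAC -det_mulmx PI det1 mul1r.
  rewrite char_poly_trig ?diag_mx_is_trig // big_map big_enum /=.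
  by apply: eq_bigr => i _; rewrite mxE eqxx mulr1n.
rewrite es (monicP (char_poly_monic A)) scale1r.
exact: prod_XsubC_eq.
Qed.

(** * The Hermitian form and Sylvester's law of inertia *)

Section Form.
Variables (n : nat) (A : 'M[C]_n).
Hypothesis hA : A ^t* = A.

Definition form (u v : 'rV[C]_n) : C := (u *m A *m v ^t*) 0 0.

Lemma formDl u1 u2 v : form (u1 + u2) v = form u1 v + form u2 v.
Proof. by rewrite /form !mulmxDl mxE. Qed.

Lemma formZl a u v : form (a *: u) v = a * form u v.
Proof. by rewrite /form -!scalemxAl mxE. Qed.

Lemma formC u v : form v u = (form u v)^*.
Proof.
have E (M : 'M[C]_1) : (M 0 0)^* = (M ^t*) 0 0 by rewrite !mxE.
have H m1 m2 m3 (X : 'M[C]_(m1, m2)) (Y : 'M[C]_(m2, m3)) :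
    (X *m Y) ^t* = Y ^t* *m X ^t* by rewrite trmx_mul map_mxM.
have K m1 m2 (X : 'M[C]_(m1, m2)) : X ^t* ^t* = X.
  by apply/matrixP => i j; rewrite !mxE conjCK.
by rewrite /form E !H K hA mulmxA.
Qed.

Lemma formDr u v1 v2 : form u (v1 + v2) = form u v1 + form u v2.
Proof. by rewrite formC formDl rmorphD /= (formC u v1) (formC u v2) !conjCK. Qed.

Lemma formZr a u v : form u (a *: v) = a^* * form u v.
Proof. by rewrite formC formZl rmorphM /= (formC u v) conjCK. Qed.

Lemma form_eigen l i z v : z *m A = l *: delta_mx 0 i -> form z v = l * (v 0 i)^*.
Proof.
move=> e; rewrite /form e -scalemxAl mxE -rowE !mxE; congr (_ * _).
Qed.

Lemma form_real u : form u u \is Num.real.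
Proof. by rewrite CrealE -formC. Qed.

(** A subspace of dimension [k], the row space of [B], on which the form is positive definite.
    Positivity already makes [B] injective: a nonzero [u] with [u *m B = 0] would give the value
    0. *)
Definition posdim k := exists B : 'M[C]_(k, n),
  forall u : 'rV_k, u != 0 -> 0 < form (u *m B) (u *m B).

Let P := spectralmx A.
Let d := spectral_diag A.

Let hP : P \in unitmx. Proof. exact: spectral_unit. Qed.
Let hPt : invmx P = P ^t*.
Proof. exact: invmx_unitary (spectral_unitarymx A). Qed.

Let hherm : A \is hermitianmx _ false Num.conj.
Proof. by apply/is_hermitianmxP; rewrite expr0 scale1r hA. Qed.

Let AE : A = invmx P *m diag_mx d *m P.
Proof. exact/orthomx_spectralP/hermitian_normalmx. Qed.

Let dreal i : d 0 i \is Num.real.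
Proof. by have /mxOverP := hermitian_spectral_diag_real hherm. Qed.

Lemma nposE : npos A = #|[set i | 0 < d 0 i]|.
Proof.
rewrite /npos (permP (eigenvalues_similar hP AE)) count_map cardE size_filter.
by rewrite -enumT; apply: eq_in_count => i _ /=; rewrite inE.
Qed.

Lemma nposNE : npos (- A) = #|[set i | d 0 i < 0]|.
Proof.
have AE' : - A = invmx P *m diag_mx (- d) *m P.
  by rewrite linearN mulmxN mulNmx -AE.
rewrite /npos (permP (eigenvalues_similar hP AE')) count_map cardE size_filter.
by rewrite -enumT; apply: eq_in_count => i _ /=; rewrite inE mxE oppr_gt0.
Qed.

Lemma rankE : \rank A = #|[set i | d 0 i != 0]|.
Proof.
rewrite AE mxrankMfree ?row_free_unit // eqmxMfull; last first.
  by rewrite row_full_unit unitmx_inv.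
set S := [set i | _]; pose k := #|S|.
(* [R] selects the coordinates with nonzero eigenvalue. Since [diag_mx d] factors through [R^T], its
   rank is at most [k]; the block [R *m diag_mx d *m R^T] is invertible of size [k]. *)
pose R : 'M[C]_(k, n) := \matrix_(r, j) (j == enum_val r)%:R.
pose e : 'rV[C]_k := \row_r d 0 (enum_val r).
have RE : R *m diag_mx d = diag_mx e *m R.
  apply/matrixP => r j; rewrite mul_mx_diag mul_diag_mx !mxE.
  by case: eqP => [->|]; rewrite ?mulr0 ?mul0r // mulr1 mul1r.
have eS : diag_mx d = R^T *m R *m diag_mx d.
  rewrite -mulmxA RE; apply/matrixP => i j; rewrite !mxE mul_diag_mx.
  have [iS|iNS] := boolP (i \in S); last first.
    have -> : d 0 i = 0 by move: iNS; rewrite inE negbK => /eqP.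
    rewrite mul0rn big1 //.
    move=> r _; rewrite !mxE; case: eqP => [er|]; last by rewrite mul0r.
    by move: iNS; rewrite er enum_valP.
  rewrite (bigD1 (enum_rank_in iS i)) //= big1 ?addr0.
    by rewrite !mxE enum_rankK_in // eqxx mul1r eq_sym; case: eqP; rewrite ?mulr1 ?mulr0.
  move=> r rN; rewrite !mxE; case: eqP => [er|]; last by rewrite mul0r.
  by case/eqP: rN; apply: enum_val_inj; rewrite enum_rankK_in.
apply/eqP; rewrite eqn_leq; apply/andP; split.
  by rewrite eS -mulmxA (leq_trans (mxrankM_maxl _ _)) // rank_leq_col.
have RR : R *m R^T = 1%:M.
  apply/matrixP => r s; rewrite !mxE (bigD1 (enum_val r)) //= big1 ?addr0.
    by rewrite !mxE eqxx mul1r (inj_eq enum_val_inj).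
  by move=> i iN; rewrite !mxE (negPf iN) mul0r.
have : \rank (R *m diag_mx d *m R^T) = k.
  rewrite RE -mulmxA RR mulmx1; apply/eqP; rewrite -/(row_free _) row_free_unit.
  rewrite unitmxE det_diag unitfE prodf_seq_neq0; apply/allP => r _ /=.
  by rewrite mxE; have := enum_valP r; rewrite inE.
move=> e0; rewrite -/k -[X in (X <= _)%N]e0 -mulmxA (leq_trans (mxrankM_maxr _ _)) //.
exact: mxrankM_maxl.
Qed.

Lemma rank_npos : \rank A = (npos A + npos (- A))%N.
Proof.
rewrite rankE nposE nposNE -cardsUI.
have -> : [set i | 0 < d 0 i] :&: [set i | d 0 i < 0] = set0.
  apply/setP => i; rewrite !inE; apply/negbTE/andP => -[h1 h2].
  by have := lt_trans h1 h2; rewrite ltxx.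
rewrite cards0 addn0; apply: eq_card => i; rewrite !inE.
by rewrite orbC -real_neqr_lt // real0.
Qed.

Lemma form_diag u : form u u = \sum_i d 0 i * `|(u *m P ^t*) 0 i| ^+ 2.
Proof.
rewrite /form [in LHS]AE hPt.
have -> : u *m (P ^t* *m diag_mx d *m P) *m u ^t* =
   (u *m P ^t*) *m diag_mx d *m (u *m P ^t*) ^t*.
  rewrite trmx_mul map_mxM -!mulmxA; congr (_ *m (_ *m (_ *m (_ *m _)))).
  by apply/matrixP => i j; rewrite !mxE; exact/esym/conjCK.
set y := u *m P ^t*; rewrite mxE; apply: eq_bigr => i _.
by rewrite mul_mx_diag !mxE mulrAC normCK mulrC.
Qed.

(** If [k] exceeded [npos A], some nonzero combination of the rows of [B] would have coordinate zero
    along every eigenvector of positive eigenvalue, and there the form is nonpositive. *)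
Lemma posdim_leq k : posdim k -> (k <= npos A)%N.
Proof.
case=> B hB; rewrite leqNgt; apply/negP; rewrite nposE => lt.
set S := [set i | _] in lt.
pose Y : 'M[C]_(k, #|S|) := \matrix_(r, j) (B *m P ^t*) r (enum_val j).
have /rowV0Pn[u /sub_kermxP uY u0] : kermx Y != 0.
  rewrite kermx_eq0 /row_free; apply/eqP => e.
  by move: lt; rewrite -e ltnNge rank_leq_col.
apply/negP: (hB u u0); rewrite -real_leNgt ?form_real ?real0 // form_diag.
apply: sumr_le0 => i _; have [iS|iNS] := boolP (i \in S).
  suff -> : (u *m B *m P ^t*) 0 i = 0 by rewrite normr0 expr0n /= mulr0.
  transitivity ((u *m Y) 0 (enum_rank_in iS i)); last by rewrite uY mxE.
  rewrite -mulmxA [LHS]mxE [RHS]mxE; apply: eq_bigr => r _; rewrite [in RHS]mxE.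
  by rewrite enum_rankK_in.
apply: mulr_le0_ge0; last by rewrite exprn_ge0.
by move: iNS; rewrite inE -real_leNgt // real0.
Qed.

Lemma posdim_npos : posdim (npos A).
Proof.
rewrite nposE; set S := [set i | _].
pose R : 'M[C]_(#|S|, n) := \matrix_(r, j) (j == enum_val r)%:R.
exists (R *m P) => u u0; rewrite form_diag.
have uE : u *m (R *m P) *m P ^t* = u *m R.
  by rewrite mulmxA -hPt mulmxK.
have RE r : (u *m R) 0 (enum_val r) = u 0 r.
  rewrite mxE (bigD1 r) //= big1 ?addr0 => [|s sN]; first by rewrite mxE eqxx mulr1.
  by rewrite mxE (inj_eq enum_val_inj) eq_sym (negPf sN) mulr0.
have R0 i : i \notin S -> (u *m R) 0 i = 0.
  move=> iN; rewrite mxE big1 // => r _; rewrite mxE; case: eqP => [e|]; last by rewrite mulr0.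
  by move: iN; rewrite e enum_valP.
have pos i : 0 <= d 0 i * `|(u *m R) 0 i| ^+ 2.
  have [iS|iNS] := boolP (i \in S); last by rewrite R0 // normr0 expr0n mulr0.
  by rewrite mulr_ge0 ?exprn_ge0 //; move: iS; rewrite inE => /ltW.
rewrite uE; have [r ur] : exists r, u 0 r != 0.
  apply/existsP; apply: contraNT u0; rewrite negb_exists => /forallP h.
  by apply/eqP/rowP => r; rewrite mxE; apply/eqP; rewrite -[_ == _]negbK.
rewrite (bigD1 (enum_val r)) //= ltr_pwDl ?sumr_ge0 // RE.
by rewrite mulr_gt0 ?exprn_gt0 ?normr_gt0 //; have := enum_valP r; rewrite inE.
Qed.

End Form.

(** Turns each later comparison of [npos A] with [npos (isomx i A)] into transporting a positive
    definite subspace. *)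
Lemma posdimP n (A : 'M[C]_n) (hA : A ^t* = A) k : posdim A k <-> (k <= npos A)%N.
Proof.
split=> [|le]; first exact: posdim_leq.
have [B hB] := posdim_npos hA.
pose R : 'M[C]_(k, npos A) := \matrix_(i, j) (j == widen_ord le i)%:R.
exists (R *m B) => u u0; rewrite mulmxA; apply: hB.
apply: contraNneq u0 => e; apply/eqP/rowP => r; rewrite mxE.
have /rowP/(_ (widen_ord le r)) := e; rewrite !mxE => <-.
rewrite (bigD1 r) //= big1 ?addr0 => [|s sN]; first by rewrite mxE eqxx mulr1.
by rewrite mxE -val_eqE /= val_eqE eq_sym (negPf sN) mulr0.
Qed.

Lemma posdim_extend n (A : 'M[C]_n) (hA : A ^t* = A) k (B : 'M[C]_(k, n)) r :
    (forall u : 'rV_k, u != 0 -> 0 < form A (u *m B) (u *m B)) ->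
    0 < form A r r -> (forall u : 'rV_k, form A (u *m B) r = 0) ->
  posdim A (k + 1).
Proof.
move=> hB hr hBr; exists (col_mx B r) => u u0.
rewrite -[u]hsubmxK mul_row_col [rsubmx u]mx11_scalar mul_scalar_mx.
set a := _ 0 0; set v := lsubmx u.
have hrB : form A r (v *m B) = 0 by rewrite formC // hBr conjC0.
rewrite formDl !formDr // !formZl !formZr // hBr hrB !mulr0 addr0 add0r mulrA -normCK.
have q0 : 0 <= `|a| ^+ 2 * form A r r by apply: mulr_ge0; [exact: exprn_ge0 | exact: ltW].
have [v0|v0] := eqVneq v 0; last by rewrite ltr_pwDl // hB.
have aN : a != 0.
  apply: contraNneq u0 => a0; rewrite -[u]hsubmxK [rsubmx u]mx11_scalar -/a a0 -/v v0.
  by rewrite (_ : 0%:M = 0) ?row_mx0 //; apply/matrixP => p q; rewrite !mxE mul0rn.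
have -> : form A (v *m B) (v *m B) = 0 by rewrite v0 /form !mul0mx mxE.
by rewrite add0r mulr_gt0 ?exprn_gt0 ?normr_gt0.
Qed.

(** Clearing row and column [i] instead of removing them keeps the size; the extra eigenvalue is 0
    and counts neither in p+ nor in p-. *)
Definition isomx n (i : 'I_n) (A : 'M[C]_n) : 'M[C]_n :=
  \matrix_(k, l) (if (k == i) || (l == i) then 0 else A k l).

(** * Effect on p+ of isolating one index *)

Section Isolate.
Variables (n : nat) (i : 'I_n) (A : 'M[C]_n).
Hypothesis hA : A ^t* = A.

Lemma isomx_herm : (isomx i A) ^t* = isomx i A.
Proof.
apply/matrixP => k l; rewrite !mxE orbC; case: ifP => _; first exact: conjC0.
by rewrite -[in RHS]hA !mxE.
Qed.

Let Z : 'M[C]_n := 1%:M - delta_mx i i.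

Let wZ (w : 'rV_n) : w *m Z = w - w 0 i *: delta_mx 0 i.
Proof.
rewrite mulmxBr mulmx1; congr (_ - _); apply/rowP => j.
rewrite mxE (bigD1 i) //= big1 ?addr0 => [|s sN]; first by rewrite !mxE !eqxx /=.
by rewrite !mxE (negPf sN) mulr0.
Qed.

Let wZi (w : 'rV_n) : (w *m Z) 0 i = 0.
Proof. by rewrite wZ !mxE !eqxx mulr1 subrr. Qed.

Lemma form_isomx w w' : form (isomx i A) w w' = form A (w *m Z) (w' *m Z).
Proof.
have ZE (w0 : 'rV_n) j : (w0 *m Z) 0 j = if j == i then 0 else w0 0 j.
  by rewrite wZ !mxE eqxx /=; case: eqP => [->|]; rewrite ?mulr1 ?subrr // mulr0 subr0.
have := ZE w; have := ZE w'; move: (w *m Z) (w' *m Z) => y y' yE' yE.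
rewrite /form !mxE; apply: eq_bigr => j _; rewrite !mxE yE'; case: (j =P i) => [->|/eqP jN].
  by rewrite big1 ?mul0r ?conjC0 ?mulr0 // => k _; rewrite !mxE eqxx orbT mulr0.
congr (_ * _); apply: eq_bigr => k _; rewrite !mxE yE (negPf jN) orbF.
by case: ifP; rewrite ?mul0r ?mulr0.
Qed.

Lemma form_isomx0 (w : 'rV_n) : w 0 i = 0 -> form (isomx i A) w w = form A w w.
Proof. by move=> w0; rewrite form_isomx wZ w0 scale0r subr0. Qed.

Lemma npos_isomx_le : (npos (isomx i A) <= npos A)%N.
Proof.
apply/(posdimP hA); have [B hB] := posdim_npos isomx_herm.
by exists (B *m Z) => u /hB; rewrite form_isomx mulmxA.
Qed.

(** Interlacing: the hyperplane of vectors vanishing at [i] meets a positive definite subspace in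
    codimension at most one, and on it the two forms agree. *)
Lemma npos_isomx_ge : (npos A <= (npos (isomx i A)).+1)%N.
Proof.
have [B hB] := posdim_npos hA; set k := npos A in B hB *.
pose K := kermx (col i B).
have rK : (k.-1 <= \rank K)%N.
  by rewrite mxrank_ker -subn1 leq_sub2l // rank_leq_col.
suff : (\rank K <= npos (isomx i A))%N by lia.
apply/(posdimP isomx_herm); exists (row_base K *m B) => u u0.
have w0 : (u *m (row_base K *m B)) 0 i = 0.
  have -> : (u *m (row_base K *m B)) 0 i = (u *m row_base K *m col i B) 0 0.
    by rewrite colE !mulmxA -colE [RHS]mxE.
  suff -> : u *m row_base K *m col i B = 0 by rewrite mxE.
  by apply/sub_kermxP; rewrite mulmx_sub // eq_row_base.
rewrite form_isomx0 // mulmxA; apply: hB.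
by rewrite mulmx_free_eq0 ?row_base_free.
Qed.

(** [z] is orthogonal to every vector vanishing at [i] and has form value [l], so it adds one
    dimension to a positive definite subspace of such vectors. *)
Lemma npos_isomx_pos (z : 'rV_n) l :
  z *m A = l *: delta_mx 0 i -> z 0 i = 1 -> 0 < l ->
  ((npos (isomx i A)).+1 <= npos A)%N.
Proof.
move=> zA zi l0; rewrite -addn1; apply/(posdimP hA).
have [B hB] := posdim_npos isomx_herm.
apply: (@posdim_extend _ _ hA _ (B *m Z) z).
- by move=> u /hB; rewrite form_isomx mulmxA.
- by rewrite (form_eigen _ zA) zi conjC1 mulr1.
- by move=> u; rewrite formC // (form_eigen _ zA) mulmxA wZi conjC0 mulr0 conjC0.
Qed.

(** Projecting along [z] onto the vectors vanishing at [i] takes away from the form the term l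
    |a|^2, which is nonpositive; positive definiteness survives. *)
Lemma npos_isomx_npos (z : 'rV_n) l :
  z *m A = l *: delta_mx 0 i -> z 0 i = 1 -> l <= 0 ->
  (npos A <= npos (isomx i A))%N.
Proof.
move=> zA zi l0; apply/(posdimP isomx_herm).
have [B hB] := posdim_npos hA.
exists (B - col i B *m z) => u u0.
set w := u *m B; set a := w 0 i; set w' := u *m _.
have w'E : w' = w - a *: z.
  rewrite /w' mulmxBr mulmxA; congr (_ - _).
  rewrite colE mulmxA -colE -/w [col i w]mx11_scalar mul_scalar_mx.
  by rewrite mxE.
have w'i : w' 0 i = 0 by rewrite w'E mxE [X in _ + X]mxE [X in - X]mxE zi mulr1 subrr.
have wE : w = w' + a *: z by rewrite w'E subrK.
rewrite form_isomx0 //; apply: lt_le_trans (hB u u0) _; rewrite -/w wE.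
have zw : form A z w' = 0 by rewrite (form_eigen _ zA) w'i conjC0 mulr0.
rewrite formDl !formDr // !formZl !formZr // zw [form A w' z]formC // zw conjC0 !mulr0.
rewrite (form_eigen _ zA) zi conjC1 mulr1 add0r addr0 mulrA -normCK gerDl.
by rewrite mulr_ge0_le0 ?exprn_ge0.
Qed.

(** [s] and the basis vector [e] at [i] span a hyperbolic plane: both are isotropic and their
    product is 1, so [e + s] has form value 2. Subtracting a suitable multiple of [s] makes a vector
    vanishing at [i] orthogonal to [e] without changing its form value. *)
Lemma npos_isomx_isotropic (s : 'rV_n) :
  s *m A = delta_mx 0 i -> s 0 i = 0 -> A i i = 0 ->
  ((npos (isomx i A)).+1 <= npos A)%N.
Proof.
move=> sA si Aii; rewrite -addn1; apply/(posdimP hA).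
have [B hB] := posdim_npos isomx_herm.
pose e : 'rV[C]_n := delta_mx 0 i.
have sA1 : s *m A = 1 *: e by rewrite scale1r.
have fs v : form A s v = (v 0 i)^* by rewrite (form_eigen _ sA1) mul1r.
have fs' v : form A v s = v 0 i by rewrite formC // fs conjCK.
have fe v : form A v e = (v *m A) 0 i.
  rewrite /form mxE (bigD1 i) //= big1 ?addr0 => [|j jN].
    by rewrite !mxE !eqxx conjC1 mulr1.
  by rewrite !mxE (negPf jN) conjC0 mulr0.
pose B' := B *m Z - col i (B *m Z *m A) *m s.
have uB u : u *m B' = u *m B *m Z - (u *m B *m Z *m A) 0 i *: s.
  rewrite mulmxBr !mulmxA; congr (_ - _).
  rewrite colE !mulmxA -colE [col i _]mx11_scalar mul_scalar_mx.
  by rewrite mxE.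
apply: (@posdim_extend _ _ hA _ B' (e + s)).
- move=> u /hB; rewrite form_isomx uB; set w := _ *m Z; set a := _ 0 i.
  rewrite -scaleNr formDl !formDr // !formZl !formZr // !fs !fs' si conjC0 !mulr0 !addr0.
  by rewrite /w wZi conjC0 !mulr0 !addr0.
- rewrite formDl !formDr // !fs !fs' si conjC0 addr0 fe -rowE !mxE Aii !eqxx /=.
  by rewrite conjC1 add0r -(natrD _ 1 1) ltr0n.
- move=> u; rewrite uB; set w := _ *m Z; set a := _ 0 i.
  rewrite -scaleNr formDl !formDr // !formZl // !fs !fs' si fe -/a /w wZi conjC0 !addr0.
  have -> : e 0 i = 1 by rewrite mxE !eqxx.
  by rewrite conjC1 mulr1 mulr0 addr0 subrr.
Qed.

End Isolate.

(** * Inertia of kernels indexed by vertices *)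

Section Kernels.

Variable T : finType.
Implicit Types (h : T -> T -> C) (x y : T) (X : {set T}).

Definition herm h := forall x y, h y x = (h x y)^*.

Definition mx_of h : 'M[C]_#|T| := \matrix_(k, l) h (enum_val k) (enum_val l).

Definition pos h := npos (mx_of h).

Definition isolate X h : T -> T -> C :=
  fun x y => if (x \in X) || (y \in X) then 0 else h x y.

Lemma eq_pos h h' : h =2 h' -> pos h = pos h'.
Proof. by move=> e; congr (npos _); apply/matrixP => k l; rewrite !mxE e. Qed.

Lemma mx_of_herm h : herm h -> (mx_of h) ^t* = mx_of h.
Proof. by move=> hh; apply/matrixP => k l; rewrite !mxE -hh. Qed.

Lemma herm_opp h : herm h -> herm (fun x y => - h x y).
Proof. by move=> hh x y; rewrite hh rmorphN. Qed.

Lemma herm_isolate X h : herm h -> herm (isolate X h).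
Proof. by move=> hh x y; rewrite /isolate orbC; case: ifP; rewrite ?conjC0. Qed.

Lemma pos0 h : (forall x y, h x y = 0) -> pos h = 0%N.
Proof.
move=> h0; apply/eqP; rewrite -leqn0 /pos.
pose O : 'M[C]_#|T| := 0.
have -> : mx_of h = O by apply/matrixP => k l; rewrite !mxE h0.
suff : (npos O <= \rank O)%N by rewrite mxrank0.
rewrite rank_npos ?leq_addr //.
by apply/matrixP => k l; rewrite !mxE conjC0.
Qed.

Lemma mx_of_isolate1 x h : mx_of (isolate [set x] h) = isomx (enum_rank x) (mx_of h).
Proof.
apply/matrixP => k l; rewrite !mxE /isolate !inE.
by rewrite -!(inj_eq enum_val_inj) enum_rankK.
Qed.

Let row_of (s : T -> C) : 'rV[C]_#|T| := \row_j s (enum_val j).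

Let row_ofM s h : row_of s *m mx_of h = row_of (fun y => \sum_x s x * h x y).
Proof.
apply/rowP => j; rewrite !mxE [RHS](reindex (@enum_val T T)) /=; last first.
  exact/onW_bij/enum_val_bij.
by apply: eq_bigr => x _; rewrite !mxE.
Qed.

Let row_of_delta l x :
  row_of (fun y => l * (y == x)%:R) = l *: delta_mx 0 (enum_rank x).
Proof.
by apply/rowP => j; rewrite !mxE -(inj_eq enum_val_inj) enum_rankK eqxx.
Qed.

Lemma pos_isolate1_le x h : herm h -> (pos (isolate [set x] h) <= pos h)%N.
Proof. by move=> hh; rewrite /pos mx_of_isolate1 npos_isomx_le // mx_of_herm. Qed.

Lemma pos_isolate1_ge x h : herm h -> (pos h <= (pos (isolate [set x] h)).+1)%N.
Proof. by move=> hh; rewrite /pos mx_of_isolate1 npos_isomx_ge // mx_of_herm. Qed.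

Lemma pos_isolate1_pos x h (z : T -> C) l : herm h ->
    (forall y, \sum_u z u * h u y = l * (y == x)%:R) -> z x = 1 -> 0 < l ->
  ((pos (isolate [set x] h)).+1 <= pos h)%N.
Proof.
move=> hh zh zx l0; rewrite /pos mx_of_isolate1.
apply: (@npos_isomx_pos _ _ _ (mx_of_herm hh) (row_of z) l) => //.
  by rewrite row_ofM -row_of_delta; apply/rowP => j; rewrite !mxE zh.
by rewrite mxE enum_rankK.
Qed.

Lemma pos_isolate1_npos x h (z : T -> C) l : herm h ->
    (forall y, \sum_u z u * h u y = l * (y == x)%:R) -> z x = 1 -> l <= 0 ->
  (pos h <= pos (isolate [set x] h))%N.
Proof.
move=> hh zh zx l0; rewrite /pos mx_of_isolate1.
apply: (@npos_isomx_npos _ _ _ (mx_of_herm hh) (row_of z) l) => //.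
  by rewrite row_ofM -row_of_delta; apply/rowP => j; rewrite !mxE zh.
by rewrite mxE enum_rankK.
Qed.

Lemma pos_isolate1_isotropic x h (s : T -> C) : herm h ->
    (forall y, \sum_u s u * h u y = (y == x)%:R) -> s x = 0 -> h x x = 0 ->
  ((pos (isolate [set x] h)).+1 <= pos h)%N.
Proof.
move=> hh sh sx hx; rewrite /pos mx_of_isolate1.
apply: (@npos_isomx_isotropic _ _ _ (mx_of_herm hh) (row_of s)).
- rewrite row_ofM -[RHS]scale1r -row_of_delta.
  by apply/rowP => j; rewrite !mxE sh mul1r.
- by rewrite mxE enum_rankK.
- by rewrite mxE enum_rankK.
Qed.

(** The matrix of [isolate X h] is Z h Z, with Z the projection off [X]. Equal inertias of both
    signs give equal ranks, so Z h has the rank, hence the row space, of h. The factor Z makes the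
    coefficients vanish on [X]. *)
Lemma isolate_row_span X h : herm h ->
    pos (isolate X h) = pos h ->
    pos (fun x y => - isolate X h x y) = pos (fun x y => - h x y) ->
  forall a, exists s : T -> C,
    (forall x, x \in X -> s x = 0) /\ forall y, \sum_x s x * h x y = h a y.
Proof.
move=> hh e1 e2 a; pose Z := diag_mx (row_of (fun x => (x \notin X)%:R)).
have rk h' : herm h' -> \rank (mx_of h') = (pos h' + pos (fun x y => - h' x y)%R)%N.
  move=> hh'; rewrite rank_npos; last exact: mx_of_herm.
  congr (_ + npos _)%N.
  by apply/matrixP => k l; rewrite !mxE.
have hm : mx_of (isolate X h) = Z *m mx_of h *m Z.
  apply/matrixP => k l; rewrite mul_diag_mx mul_mx_diag !mxE /isolate.
  by case: (_ \in X); case: (_ \in X); rewrite ?mul0r ?mulr0 ?mul1r ?mulr1.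
have rE : \rank (mx_of h) = \rank (Z *m mx_of h).
  apply/eqP; rewrite eqn_leq mxrankM_maxr andbT rk // -e1 -e2 -rk; last exact: herm_isolate.
  by rewrite hm mxrankM_maxl.
have /submxP[S hS] : (mx_of h <= Z *m mx_of h)%MS.
  by have [_ <-] := mxrank_leqif_sup (submxMl Z (mx_of h)); rewrite rE.
pose s x := (row (enum_rank a) S *m Z) 0 (enum_rank x).
have sE : row_of s = row (enum_rank a) S *m Z.
  by apply/rowP => j; rewrite mxE /s enum_valK.
exists s; split => [x xX|y].
  by rewrite /s mul_mx_diag mxE !mxE enum_rankK xX mulr0.
have := row_ofM s h; rewrite sE -mulmxA -row_mul -hS.
by move=> /rowP/(_ (enum_rank y)); rewrite !mxE !enum_rankK.
Qed.

End Kernels.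

End PositiveInertia.

Lemma connect_restrict (T : finType) (e e' : rel T) z w : connect e z w ->
  (forall u v, connect e z u -> e u v -> e' u v) -> connect e' z w.
Proof.
case/connectP=> p; elim: p z w => [|y p IH] z w /= => [_ -> _|/andP[zy yp] wE H].
  exact: connect0.
apply: connect_trans (connect1 (H _ _ (connect0 _ _) zy)) (IH y w yp wE _).
by move=> u v yu; apply: H; apply: connect_trans (connect1 zy) yu.
Qed.

(** * Edge deletion and the cyclomatic number *)

Section Deletion.

Variable T : finType.
Implicit Types (G : mixedGraph T) (D M N : {set {set T}}) (X : {set T}).
Implicit Types (x y a b u v : T) (e : {set T}) (c : seq T).

Lemma set2_eq a b u v : [set a; b] = [set u; v] ->
  (a = u /\ b = v) \/ (a = v /\ b = u).
Proof.
move=> E; have := set21 a b; have := set22 a b; have := set21 u v; have := set22 u v.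
rewrite -{1 2}E {3 4}E !inE.
by do 4![case/orP=> /eqP ?]; subst; auto.
Qed.

Lemma adjC G x y : adj G x y = adj G y x. Proof. exact: adj_sym. Qed.

Lemma edgesP G e : reflect (exists x y, adj G x y /\ e = [set x; y]) (e \in edges G).
Proof.
apply: (iffP imsetP) => [[[a b] /= ab ->]|[a [b [ab ->]]]].
  by exists a, b; move: ab; rewrite inE.
by exists (a, b); rewrite // inE.
Qed.

Lemma in_edges G x y : ([set x; y] \in edges G) = adj G x y.
Proof.
apply/edgesP/idP => [[a [b [ab /set2_eq[] []-> ->]]]|xy] //; first by rewrite adjC.
by exists x, y.
Qed.

Lemma adj_neq G x y : adj G x y -> x != y.
Proof. by apply: contraTneq => ->; rewrite adj_irr. Qed.

(* Subgraphs keep the vertex set [T]: a vertex is removed by deleting the edges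
   at it (see [star]).  The isolated vertices so created change neither p+ nor
   the matching number, nor the cyclomatic number. *)
Section Del.
Variables (G : mixedGraph T) (D : {set {set T}}).

Definition del_adj x y := adj G x y && ([set x; y] \notin D).
Definition del_arc x y := Defs.arc G x y && ([set x; y] \notin D).

Lemma del_adj_sym : symmetric del_adj.
Proof. by move=> x y; rewrite /del_adj adjC setUC. Qed.

Lemma del_adj_irr : irreflexive del_adj.
Proof. by move=> x; rewrite /del_adj adj_irr. Qed.

Lemma del_arc_adj x y : del_arc x y -> del_adj x y.
Proof. by case/andP=> /arc_adj xy xyD; rewrite /del_adj xy. Qed.

Lemma del_arc_asym x y : del_arc x y -> ~~ del_arc y x.
Proof. by case/andP=> /arc_asym/negPf yx _; rewrite /del_arc yx. Qed.

Definition del := MixedGraph del_adj_sym del_adj_irr del_arc_adj del_arc_asym.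

Lemma edges_del : edges del = edges G :\: D.
Proof.
apply/setP => e; apply/edgesP/setDP => [[x [y [/andP[xy xyD] ->]]]|[/edgesP[x [y [xy ->]]] xyD]].
  by rewrite in_edges.
by exists x, y; rewrite /= /del_adj xy.
Qed.

End Del.

Definition subgraph G' G := subrel (adj G') (adj G).

Lemma del_sub G D : subgraph (del G D) G.
Proof. by move=> x y /andP[]. Qed.

Lemma sub_del G D D' : D' \subset D -> subgraph (del G D) (del G D').
Proof.
move=> /subsetP s x y /andP[xy xyD]; rewrite /= /del_adj xy; apply: contra xyD.
exact: s.
Qed.

Lemma sub_edges G' G : subgraph G' G -> edges G' \subset edges G.
Proof.
by move=> s; apply/subsetP => e /edgesP[x [y [/s xy ->]]]; rewrite in_edges.
Qed.

Lemma edges_sub G' G : edges G' \subset edges G -> subgraph G' G.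
Proof. by move=> /subsetP s x y; rewrite -!in_edges; apply: s. Qed.

Lemma sub_trans G1 G2 G3 : subgraph G1 G2 -> subgraph G2 G3 -> subgraph G1 G3.
Proof. by move=> s1 s2 x y /s1/s2. Qed.

Lemma del_edges_lt G D e : e \in edges G -> e \in D ->
  (#|edges (del G D)| < #|edges G|)%N.
Proof.
move=> eG eD; rewrite edges_del; apply: proper_card; rewrite properE subsetDl /=.
by apply/subsetPn; exists e; rewrite // !inE eD.
Qed.

(** All sets meeting [X], edges or not, so that one expression isolates [X] in any graph. *)
Definition star X : {set {set T}} := [set e : {set T} | ~~ [disjoint e & X]].

Lemma in_star X x y : ([set x; y] \in star X) = (x \in X) || (y \in X).
Proof.
rewrite inE; apply/pred0Pn/orP => [[z /=]|[xX|yX]].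
- by rewrite !inE => /andP[/orP[]/eqP->]; auto.
- by exists x; rewrite /= !inE eqxx.
- by exists y; rewrite /= !inE eqxx orbT.
Qed.

Lemma adj_del_star G X x y :
  adj (del G (star X)) x y = [&& adj G x y, x \notin X & y \notin X].
Proof. by rewrite /= /del_adj in_star negb_or. Qed.

Lemma hentry_del (C : numClosedFieldType) G D x y :
  hentry (del G D) C x y = if [set x; y] \in D then 0 else hentry G C x y.
Proof.
rewrite /hentry /= /del_adj /del_arc [[set y; x]]setUC.
by case: (_ \in D); rewrite ?andbF ?andbT.
Qed.

Lemma hentry_star (C : numClosedFieldType) G X :
  hentry (del G (star X)) C =2 isolate X (hentry G C).
Proof. by move=> x y; rewrite hentry_del in_star. Qed.

Lemma hentry_herm (C : numClosedFieldType) G : herm (hentry G C).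
Proof.
move=> x y; rewrite /hentry adjC; case: ifP => [yx|_].
  by have /negPf-> := arc_asym yx; rewrite rmorphN /= conjCi opprK.
case: ifP => _; first by rewrite conjCi.
by case: ifP; rewrite ?conjC1 ?conjC0.
Qed.

Lemma hentry_eq0 (C : numClosedFieldType) G x y : ~~ adj G x y -> hentry G C x y = 0.
Proof.
move=> /[dup] Nxy /negPf xy; rewrite /hentry xy; case: ifP => [/arc_adj|_].
  by rewrite xy.
by case: ifP => [/arc_adj|//]; rewrite adjC xy.
Qed.

Lemma connC G : connect_sym (adj G).
Proof. exact/sym_connect_sym/adj_sym. Qed.

Lemma connect_sub_graph G' G : subgraph G' G -> subrel (connect (adj G')) (connect (adj G)).
Proof. by move=> s; apply: connect_sub => x y /s; apply: connect1. Qed.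

Lemma cyclomatic_eq G G' : edges G = edges G' -> cyclomatic G = cyclomatic G'.
Proof.
move=> e; rewrite /cyclomatic e; congr (_ + Posz _).
rewrite /ncomponents; apply: eq_n_comp; apply: eq_connect => x y.
by rewrite -!in_edges e.
Qed.

(** Only the component containing the edge is affected. It is [A], and without the edge it consists
    of the classes of [a] and [b], which are one or two. *)
Lemma ncomponents_del1 G a b : adj G a b ->
  ncomponents (del G [set [set a; b]]) =
  (ncomponents G + ~~ connect (adj (del G [set [set a; b]])) a b)%N.
Proof.
move=> ab; set G' := del _ _; set e := adj G; set e' := adj G'.
have se : connect_sym e by apply: connC.
have se' : connect_sym e' by apply: connC.
have s : subrel (connect e') (connect e) := connect_sub_graph (@del_sub _ _).
have stepE u v : e u v -> e' u v \/ ((u = a /\ v = b) \/ (u = b /\ v = a)).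
  move=> uv; have [/set1P/set2_eq|h] := boolP ([set u; v] \in [set [set a; b]]).
    by auto.
  by left; apply/andP.
pose A := [pred z | connect e' a z || connect e' b z].
have clA' : closed e' A.
  by move=> u v /connect1 uv; rewrite !inE !(same_connect_r se' uv).
have clA : closed e A.
  apply: intro_closed => // u v /stepE[/clA' <-|[[-> ->]|[-> ->]]] //.
    by move=> _; rewrite !inE connect0 orbT.
  by move=> _; rewrite !inE connect0.
have eqA z w : z \notin A -> connect e z w = connect e' z w.
  move=> zA; apply/idP/idP; last exact: s.
  move=> zw; apply: connect_restrict zw _ => u v zu /stepE[//|h].
  have uA : u \notin A.
    by rewrite -(closed_connect clA zu).
  by case: h => -[uE _]; move: uA; rewrite uE !inE connect0 ?orbT.
have e1 : n_comp e A = 1%N.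
  rewrite -(n_comp_connect se a); apply: eq_n_comp_r => z; rewrite inE.
  apply/orP/idP => [[/s //|/s bz]|az]; first exact: connect_trans (connect1 ab) bz.
  by have := closed_connect clA az; rewrite !inE connect0 /= => /esym/orP.
have e2 : n_comp e' A = (~~ connect e' a b).+1.
  rewrite -(n_comp_closure2 se'); apply: eq_n_comp_r => z; rewrite inE.
  apply/orP/pred0Pn => [[az|bz]|[w /= /andP[zw]]].
  - by exists a; rewrite !inE eqxx andbT [connect _ _ _]se'.
  - by exists b; rewrite !inE eqxx orbT andbT [connect _ _ _]se'.
  by rewrite !inE => /orP[]/eqP wE; move: zw; rewrite wE inE se'; [left|right].
rewrite /ncomponents (n_compC A) [in RHS](n_compC A) e1 e2.
have -> : n_comp e' [predC A] = n_comp e [predC A]; last by rewrite addnC add1n -addSnnS.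
apply: eq_card => z; rewrite !inE; case: (boolP (_ || _)) => zA; rewrite ?andbF //= !andbT.
(* Outside [A] even the representatives agree, since [fingraph.root] picks from the class as a
   predicate. *)
have E : pick (connect e z) = pick (connect e' z) by apply: eq_pick => w; apply: eqA.
by rewrite /roots /fingraph.root E.
Qed.

Lemma cyclomatic_del1 G a b : adj G a b ->
  cyclomatic (del G [set [set a; b]]) =
  cyclomatic G - (connect (adj (del G [set [set a; b]])) a b)%:R.
Proof.
move=> ab; rewrite /cyclomatic ncomponents_del1 // edges_del.
have := cardsD1 [set a; b] (edges G); rewrite in_edges ab => ->.
move: (#|_ :\: _|) (ncomponents G) (#|T|) => p q r; case: connect => /=;
  rewrite ?addn0 ?addn1 ?mulr1n ?mulr0n; lia.
Qed.

End Deletion.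

Arguments del_adj : simpl never.

(** * Cycles, bridges and the cyclomatic number *)

Section Cycles.

Variable T : finType.
Implicit Types (G : mixedGraph T) (D M N : {set {set T}}) (X : {set T}).
Implicit Types (x y a b u v : T) (e : {set T}) (c : seq T).

Lemma cycle_edgesP c e :
  reflect (exists2 x, x \in c & e = [set x; next c x]) (e \in cycle_edges c).
Proof. exact: imsetP. Qed.

Lemma cycle_edge_mem c u v : [set u; v] \in cycle_edges c ->
  [/\ u \in c, v \in c & v = next c u \/ u = next c v].
Proof.
case/cycle_edgesP=> x xc /set2_eq[] [-> ->].
  by rewrite mem_next; split; auto.
by rewrite mem_next; split; auto.
Qed.

Lemma next_cycle_edge c x : x \in c -> [set x; next c x] \in cycle_edges c.
Proof. by move=> xc; apply/cycle_edgesP; exists x. Qed.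

Lemma is_cycle_edges G c : is_cycle G c -> cycle_edges c \subset edges G.
Proof.
case/and3P=> _ _ cc; apply/subsetP => _ /cycle_edgesP[x xc ->].
by rewrite in_edges next_cycle.
Qed.

Lemma is_cycle_of_edges G G' c : is_cycle G c -> cycle_edges c \subset edges G' ->
  is_cycle G' c.
Proof.
case/and3P=> c2 uc cc /subsetP s; rewrite /is_cycle c2 uc /=.
by apply: cycle_from_next => // x xc; rewrite -in_edges s // next_cycle_edge.
Qed.

Lemma is_cycle_sub G' G c : subgraph G' G -> is_cycle G' c -> is_cycle G c.
Proof.
move=> s cc; apply: (is_cycle_of_edges cc).
exact: subset_trans (is_cycle_edges cc) (sub_edges s).
Qed.

Lemma is_cycle_del G D c : is_cycle G c -> [disjoint cycle_edges c & D] ->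
  is_cycle (del G D) c.
Proof.
move=> cc dD; apply: (is_cycle_of_edges cc).
by rewrite edges_del subsetD dD is_cycle_edges.
Qed.

Lemma cycle_edges_disjoint_del G D c : is_cycle (del G D) c ->
  [disjoint cycle_edges c & D].
Proof. by move/is_cycle_edges; rewrite edges_del subsetD => /andP[]. Qed.

Lemma is_cycle_star G X c : is_cycle G c -> (forall x, x \in c -> x \notin X) ->
  is_cycle (del G (star X)) c.
Proof.
move=> cc cX; apply: is_cycle_del => //; rewrite disjoint_subset; apply/subsetP.
by move=> _ /cycle_edgesP[x xc ->]; rewrite inE in_star negb_or !cX // mem_next.
Qed.

Lemma cycle_connect G c : is_cycle G c -> {in c &, forall x y, connect (adj G) x y}.
Proof. by case/and3P=> _ _; apply: connect_cycle. Qed.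

Lemma cycle_edges_neq0 G c : is_cycle G c -> exists e, e \in cycle_edges c.
Proof.
case: c => [|x c] // _; exists [set x; next (x :: c) x].
by rewrite next_cycle_edge ?mem_head.
Qed.

(** A simple path from [a] to [b] without the edge closes up with it. The result has at least three
    vertices because the direct step from [a] to [b] is the deleted edge. *)
Lemma cycle_of_connect G a b : adj G a b ->
    connect (adj (del G [set [set a; b]])) a b ->
  exists c, is_cycle G c /\ [set a; b] \in cycle_edges c.
Proof.
move=> ab /connectP[p0 /shortenP[p pp up _] bE].
have ppG : path (adj G) a p by apply: sub_path pp => u v; apply: del_sub.
exists (a :: p); have c0 : cycle (adj G) (a :: p).
  by rewrite /= rcons_path ppG -bE adjC.
split.
  rewrite /is_cycle up c0 !andbT; case: p {ppG up c0} pp bE => [|y [|z p]] //=.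
    by move=> _ e; move: ab; rewrite e adj_irr.
  by rewrite andbT => /andP[_ /negP h] e; case: h; rewrite e set11.
apply/cycle_edgesP; exists b; first by rewrite bE mem_last.
rewrite setUC; congr [set _; _].
(* [b] comes last, so [next] falls back on the default of [nth], which is the head [a]. *)
by rewrite next_nth bE mem_last index_last // nth_default.
Qed.

Lemma connect_of_cycle G c x : is_cycle G c -> x \in c ->
  connect (adj (del G [set [set x; next c x]])) x (next c x).
Proof.
case/and3P=> c2 uc cc xc; have [i p rip] := rot_to xc.
rewrite -(next_rot i) // {xc}; move: c2 uc cc.
rewrite -(size_rot i) -(rot_uniq i) -(rot_cycle i) rip.
case: p {rip} => [|y [|z p]] //= _ /and3P[xp yp _] /and3P[xy yz zp].
rewrite eqxx -[del_adj _ _]/(adj (del G _)) connC.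
apply/connectP; exists (z :: rcons p x); last by rewrite /= last_rcons.
have yx : y != x by rewrite eq_sym; apply: contraNneq xp => ->; rewrite mem_head.
have zx : z != x by rewrite eq_sym; apply: contraNneq xp => ->; rewrite !inE eqxx orbT.
rewrite /= {1}/del_adj yz /= inE; apply/andP; split.
  by apply/negP => /eqP/set2_eq[][] h1 h2; move: yx zx; rewrite ?h1 ?h2 eqxx.
have {xp}xp : x \notin z :: p by move: xp; rewrite inE negb_or => /andP[].
elim: p z zp xp yp {yz zx} => [|w p IH] z /=.
  rewrite !andbT !in_cons !orbF => zx xz yz; rewrite /del_adj zx inE /=.
  by apply/negP => /eqP/set2_eq[][] h1 h2; [move: xz|move: yz]; rewrite h1 eqxx.
rewrite !in_cons !negb_or => /andP[zw wp] /andP[xz xp] /andP[yz yp].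
rewrite IH ?in_cons ?negb_or ?xz ?yz // andbT /del_adj zw inE /=.
by apply/negP => /eqP/set2_eq[][] h1 h2; [move: xz|move: yz]; rewrite h1 eqxx.
Qed.

Lemma connect_of_cycle_edge G c a b : is_cycle G c -> [set a; b] \in cycle_edges c ->
  connect (adj (del G [set [set a; b]])) a b.
Proof.
move=> cc /cycle_edge_mem[ac bc [->|->]]; first exact: connect_of_cycle.
by rewrite setUC connC; exact: connect_of_cycle.
Qed.

Definition on_cycle G e := exists c, is_cycle G c /\ e \in cycle_edges c.

Lemma on_cycle_sub G' G e : subgraph G' G -> on_cycle G' e -> on_cycle G e.
Proof. by move=> s [c [cc ec]]; exists c; split=> //; apply: is_cycle_sub cc. Qed.

(** The missing edges go one at a time. Each is a bridge, since an edge whose ends stay connected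
    lies on a cycle, and losing a bridge trades one edge for one component. *)
Lemma cyclomatic_sub_eq G' G : subgraph G' G ->
    (forall e, e \in edges G -> e \notin edges G' -> ~ on_cycle G e) ->
  cyclomatic G' = cyclomatic G.
Proof.
move=> s; have [n] := ubnP #|edges G :\: edges G'|; elim: n G s => // n IH G s.
rewrite ltnS => le nc; have [e0|/set0Pn[e]] := eqVneq (edges G :\: edges G') set0.
  apply: cyclomatic_eq; apply/eqP; rewrite eqEsubset sub_edges //=.
  by rewrite -setD_eq0 e0.
rewrite inE => /andP[eG' eG]; have /edgesP[a [b [ab eE]]] := eG.
pose G1 := del G [set e].
have s1 : subgraph G' G1.
  by apply: edges_sub; rewrite edges_del subsetD1 sub_edges.
rewrite (IH G1 s1); first last.
- move=> f; rewrite edges_del => /setDP[fG _] fG' fc; apply: nc fG fG' _.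
  by apply: on_cycle_sub fc; apply: del_sub.
- apply: leq_trans le; apply: proper_card.
  rewrite edges_del properEneq; apply/andP; split; last by rewrite setSD ?subsetDl.
  by apply/eqP => /setP/(_ e); rewrite !inE eqxx eG' eG.
rewrite /G1 eE cyclomatic_del1 //; case: (boolP (connect _ _ _)) => [h|_]; last by rewrite subr0.
by case: (nc e) => //; rewrite eE; apply: cycle_of_connect.
Qed.

Lemma cyclomatic_sub G' G : subgraph G' G -> cyclomatic G' <= cyclomatic G.
Proof.
move=> s; have [n] := ubnP #|edges G :\: edges G'|; elim: n G s => // n IH G s.
rewrite ltnS => le; have [e0|/set0Pn[e]] := eqVneq (edges G :\: edges G') set0.
  rewrite (@cyclomatic_eq _ G' G) //; apply/eqP; rewrite eqEsubset sub_edges //=.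
  by rewrite -setD_eq0 e0.
rewrite inE => /andP[eG' eG]; have /edgesP[a [b [ab eE]]] := eG.
pose G1 := del G [set e].
have s1 : subgraph G' G1.
  by apply: edges_sub; rewrite edges_del subsetD1 sub_edges.
apply: le_trans (IH G1 s1 _) _.
  apply: leq_trans le; apply: proper_card.
  rewrite edges_del properEneq; apply/andP; split; last by rewrite setSD ?subsetDl.
  by apply/eqP => /setP/(_ e); rewrite !inE eqxx eG' eG.
by rewrite /G1 eE cyclomatic_del1 // gerBl ler0n.
Qed.

Lemma cyclomatic_del_on_cycle G e : on_cycle G e ->
  cyclomatic (del G [set e]) = cyclomatic G - 1.
Proof.
case=> c [cc ec]; have /edgesP[a [b [ab eE]]] := subsetP (is_cycle_edges cc) _ ec.
by rewrite eE cyclomatic_del1 // (connect_of_cycle_edge cc) -?eE.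
Qed.

Lemma cyclomatic0 G : edges G = set0 -> cyclomatic G = 0.
Proof.
move=> e0; rewrite /cyclomatic e0 cards0 /ncomponents.
suff -> : n_comp (adj G) T = #|T| by rewrite sub0r addNr.
apply: eq_card => x; rewrite !inE andbT /roots.
have /connectP[p pp ->] := connect_root (adj G) x.
case: p pp => [|y p] /=; first by rewrite eqxx.
by rewrite -in_edges e0 inE.
Qed.

Lemma cyclomatic_acyclic G : (forall c, ~ is_cycle G c) -> cyclomatic G = 0.
Proof.
move=> nc; rewrite -(@cyclomatic_sub_eq (del G (edges G)) G).
- by apply: cyclomatic0; rewrite edges_del setDv.
- exact: del_sub.
by move=> e _ _ [c [cc _]]; apply: nc cc.
Qed.

Lemma star_sub_del1 G x e : x \in e -> subgraph (del G (star [set x])) (del G [set e]).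
Proof.
move=> xe; apply: sub_del; apply/subsetP => _ /set1P->.
by rewrite inE disjoint_sym disjoints1 negbK.
Qed.

Lemma cyclomatic_star_cycle G c x : is_cycle G c -> x \in c ->
  cyclomatic (del G (star [set x])) <= cyclomatic G - 1.
Proof.
move=> cc xc; rewrite -(@cyclomatic_del_on_cycle _ [set x; next c x]).
  by apply: cyclomatic_sub; apply: star_sub_del1; rewrite set21.
by exists c; split=> //; apply: next_cycle_edge.
Qed.

(** If [c1] never left [c2] at a common vertex, going round [c1] from [x] would keep all its
    vertices, and then all its edges, in [c2]. *)
Lemma cycle_edges_diverge c1 c2 x : uniq c1 -> x \in c1 -> x \in c2 ->
    ~~ (cycle_edges c1 \subset cycle_edges c2) ->
  exists y, [/\ y \in c1, y \in c2 & [set y; next c1 y] \notin cycle_edges c2].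
Proof.
move=> uc xc1 xc2 ns.
have [/existsP[y /and3P[h1 h2 h3]]|] :=
  boolP [exists y, [&& y \in c1, y \in c2 & [set y; next c1 y] \notin cycle_edges c2]].
  by exists y.
rewrite negb_exists => /forallP h; case/negP: ns.
have step y : y \in c1 -> y \in c2 -> [set y; next c1 y] \in cycle_edges c2.
  by move=> yc1 yc2; have := h y; rewrite yc1 yc2 negbK.
suff sc y : y \in c1 -> y \in c2.
  by apply/subsetP => _ /cycle_edgesP[y yc1 ->]; apply: step => //; apply: sc.
move=> yc1; have := connect_cycle (cycle_next uc) xc1 yc1.
case/connectP=> p; elim: p x xc1 xc2 => [|z p IH] x xc1 xc2 /=; first by move=> _ ->.
case/andP=> /eqP zE pp; apply: IH => //; rewrite -zE ?mem_next //.
by have [] := cycle_edge_mem (step x xc1 xc2).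
Qed.

(** Removing the edge by which [c1] leaves [c2] costs one and keeps [c2], which still passes through
    [x]; isolating [x] then costs another one. *)
Lemma cyclomatic_star_two_cycles G c1 c2 x : is_cycle G c1 -> is_cycle G c2 ->
    x \in c1 -> x \in c2 -> [set x; next c1 x] \notin cycle_edges c2 ->
  cyclomatic (del G (star [set x])) <= cyclomatic G - 2.
Proof.
move=> cc1 cc2 xc1 xc2 ne; pose e := [set x; next c1 x].
have on1 : on_cycle G e by exists c1; split=> //; apply: next_cycle_edge.
have cc2' : is_cycle (del G [set e]) c2.
  by apply: is_cycle_del => //; rewrite disjoint_sym disjoints1.
have := cyclomatic_star_cycle cc2' xc2.
rewrite cyclomatic_del_on_cycle // => le.
rewrite (_ : cyclomatic G - 2 = cyclomatic G - 1 - 1); last by lia.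
apply: le_trans le; apply: cyclomatic_sub => u v; rewrite !adj_del_star => /and3P[uv ux vx].
rewrite ux vx !andbT /= /del_adj uv inE /=; apply/negP => /eqP uve.
have : x \in [set u; v] by rewrite uve set21.
by rewrite !inE => /orP[]/eqP xE; move: ux vx; rewrite -xE !inE eqxx.
Qed.

Lemma cycles_disjoint_sub G' G : subgraph G' G -> cycles_disjoint G -> cycles_disjoint G'.
Proof. by move=> s dG c1 c2 /(is_cycle_sub s) h1 /(is_cycle_sub s) h2; apply: dG. Qed.

Lemma cycles_disjoint_edges G c1 c2 x : cycles_disjoint G ->
    is_cycle G c1 -> is_cycle G c2 -> x \in c1 -> x \in c2 ->
  cycle_edges c1 = cycle_edges c2.
Proof.
move=> dG h1 h2 x1 x2; apply/eqP; apply/negPn/negP => ne.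
by have := dG _ _ h1 h2 ne x x1; rewrite x2.
Qed.

Lemma cycle_edges_mem c1 c2 x : cycle_edges c1 = cycle_edges c2 -> x \in c1 -> x \in c2.
Proof.
by move=> e x1; have := next_cycle_edge x1; rewrite e => /cycle_edge_mem[].
Qed.

Lemma cycles_disjoint_edge_connect G c a b : cycles_disjoint G -> is_cycle G c ->
    a \in c -> adj G a b -> connect (adj (del G [set [set a; b]])) a b ->
  [set a; b] \in cycle_edges c.
Proof.
move=> dG cc ac ab /(cycle_of_connect ab)[c' [cc' ec']].
have [ac' _ _] := cycle_edge_mem ec'.
by rewrite (cycles_disjoint_edges dG cc cc' ac ac').
Qed.

(** [c] survives the removal of a chord and joins its ends, so the chord would lie on a cycle
    through [a], which can only be [c]. *)
Lemma cycles_disjoint_chordless G c a b : cycles_disjoint G -> is_cycle G c ->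
  a \in c -> b \in c -> adj G a b -> [set a; b] \in cycle_edges c.
Proof.
move=> dG cc ac bc ab; have [//|ne] := boolP ([set a; b] \in cycle_edges c).
have cc' : is_cycle (del G [set [set a; b]]) c.
  by apply: is_cycle_del => //; rewrite disjoint_sym disjoints1.
rewrite -(negPf ne); apply: (cycles_disjoint_edge_connect dG cc ac ab).
exact: cycle_connect cc' _ _ ac bc.
Qed.

(** The first edge of a simple path off [c] from [a] to [b] lies on a cycle, because the rest of the
    path and [c] reconnect its ends. That cycle contains [a], so the edge would belong to [c]. *)
Lemma cycles_disjoint_separated G c a b : cycles_disjoint G -> is_cycle G c ->
    a \in c -> b \in c -> connect (adj (del G (cycle_edges c))) a b -> a = b.
Proof.
move=> dG cc ac bc /connectP[p0 /shortenP[p pp up _] bE].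
case: p pp up bE => [//|a' p] /= /andP[/andP[aa' ne] pp] /andP[ap _] bE.
case/negP: (ne); apply: (cycles_disjoint_edge_connect dG cc ac aa').
rewrite connC; apply: (@connect_trans _ _ b).
  apply/connectP; exists p => //.
  apply: (@sub_in_path _ (predC1 a)) pp; last first.
    by apply/allP => z zp; apply: contraNneq ap => <-.
  move=> u v ua va /andP[uv _]; rewrite /= /del_adj uv inE.
  by apply/negP => /eqP/set2_eq[][] h1 h2; move: ua va; rewrite !inE ?h1 ?h2 eqxx.
apply: cycle_connect bc ac; apply: is_cycle_del => //.
by rewrite disjoint_sym disjoints1.
Qed.

(** [B x y] is the side of [x] when the bridge xy is cut. If [x] has a neighbour z other than [y],
    the side of z when zx is cut lies inside it and misses [x]; a smallest side thus yields a
    pendant vertex. *)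
Lemma acyclic_pendant G a b : (forall c, ~ is_cycle G c) -> adj G a b ->
  exists u v, adj G u v /\ forall w, adj G u w -> w = v.
Proof.
move=> nc; pose B x y := [set w | connect (adj (del G [set [set x; y]])) x w].
have br x y : adj G x y -> ~~ connect (adj (del G [set [set x; y]])) x y.
  by move=> xy; apply/negP => /(cycle_of_connect xy)[c [cc _]]; apply: nc cc.
have [n] := ubnP #|B a b|; elim: n a b => // n IH x y; rewrite ltnS => le xy.
have [/existsP[z /andP[xz zy]]|] := boolP [exists z, adj G x z && (z != y)]; last first.
  rewrite negb_exists => /forallP h; exists x, y; split=> // w xw.
  by have := h w; rewrite xw negbK => /eqP.
have zx : adj G z x by rewrite adjC.
apply: (IH z x) => //; apply: leq_trans le; apply: proper_card.
apply/properP; split; last first.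
  by exists x; rewrite !inE ?connect0 // br.
apply/subsetP => w; rewrite !inE => zw.
apply: (@connect_trans _ _ z).
  apply: connect1; rewrite /= /del_adj xz inE; apply/negP => /eqP/set2_eq[][] h1 h2.
    by rewrite h2 eqxx in zy.
  by move: xy; rewrite -h1 adj_irr.
apply: connect_restrict zw _ => u v zu /[dup] uv' /andP[uv _].
rewrite /= /del_adj uv inE; apply/negP => /eqP/set2_eq[][] h1 h2.
  by case/negP: (br z x zx); rewrite -[X in connect _ _ X]h1.
by case/negP: (br z x zx); rewrite -[X in connect _ _ X]h2 (connect_trans zu) // connect1.
Qed.

End Cycles.

(** * Matchings *)

Section Matchings.

Variable T : finType.
Implicit Types (G : mixedGraph T) (D M N : {set {set T}}) (X R : {set T}).
Implicit Types (x y a b u v : T) (e f : {set T}) (c s : seq T).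

(** Once a cycle edge at [x] is gone, disjointness leaves no cycle through [x], so the other edges
    at [x] are bridges. *)
Lemma cyclomatic_star_cycle_eq G c x : cycles_disjoint G -> is_cycle G c -> x \in c ->
  cyclomatic (del G (star [set x])) = cyclomatic G - 1.
Proof.
move=> dG cc xc; pose e := [set x; next c x].
have ec : e \in cycle_edges c by apply: next_cycle_edge.
rewrite -(@cyclomatic_del_on_cycle _ _ e); last by exists c.
apply: cyclomatic_sub_eq; first by apply: star_sub_del1; rewrite set21.
move=> f fG fN [c' [cc' fc']].
have xc' : x \in c'.
  have /edgesP[u [v [uv fE]]] := subsetP (is_cycle_edges cc') _ fc'.
  move: fN; rewrite edges_del in_setD negb_and negbK orbC.
  have -> : f \in edges G by move: fG; rewrite edges_del in_setD => /andP[].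
  move: fc'; rewrite fE in_star !inE /= => /cycle_edge_mem[uc vc _].
  by case/orP=> /eqP<-.
have := cycle_edges_disjoint_del cc'.
rewrite (cycles_disjoint_edges dG (is_cycle_sub (@del_sub _ _ _) cc') cc xc' xc).
by rewrite disjoint_sym disjoints1 ec.
Qed.

(** By disjointness no cycle of G - E(c) meets [c], so only bridges are removed. *)
Lemma cyclomatic_cut_cycle G c : cycles_disjoint G -> is_cycle G c ->
  cyclomatic (del (del G (cycle_edges c)) (star [set x in c])) =
  cyclomatic (del G (cycle_edges c)).
Proof.
move=> dG cc; apply: cyclomatic_sub_eq; first exact: del_sub.
move=> f fG fN [c' [cc' fc']].
have [x xc xc'] : exists2 x, x \in c & x \in c'.
  have /edgesP[u [v [uv fE]]] := subsetP (is_cycle_edges cc') _ fc'.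
  move: fN; rewrite edges_del in_setD negb_and negbK fG orbF.
  move: fc'; rewrite fE in_star !inE /= => /cycle_edge_mem[uc vc _].
  by case/orP=> ?; [exists u|exists v].
have := cycle_edges_disjoint_del cc'.
rewrite (cycles_disjoint_edges dG (is_cycle_sub (@del_sub _ _ _) cc') cc xc' xc).
have [g gc] := cycle_edges_neq0 cc.
by move/disjointFr => /(_ _ gc); rewrite gc.
Qed.

Lemma matchingP G M : reflect
  (M \subset edges G /\ forall e f x, e \in M -> f \in M -> x \in e -> x \in f -> e = f)
  (matching G M).
Proof.
apply: (iffP andP) => -[h1 h2]; split=> //.
  move=> e f x eM fM xe xf; apply/eqP; apply/negPn/negP => ne.
  by have := trivIsetP h2 _ _ eM fM ne; move/disjointFr => /(_ _ xe); rewrite xf.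
apply/trivIsetP => e f eM fM; apply: contraR => /pred0Pn[x /= /andP[xe xf]].
by apply/eqP; apply: h2 eM fM xe xf.
Qed.

Lemma matching_edges G M e : matching G M -> e \in M -> e \in edges G.
Proof. by case/andP=> /subsetP s _; apply: s. Qed.

Lemma matching_leq G M : matching G M -> (#|M| <= matching_number G)%N.
Proof. by move=> mM; apply: leq_bigmax_cond. Qed.

Lemma maximum_matching_ex G : exists M, maximum_matching G M.
Proof.
have m0 : matching G set0.
  by apply/matchingP; split=> [|e f x]; rewrite ?sub0set // inE.
have c0 : (0 < #|[pred M | matching G M]|)%N by apply/card_gt0P; exists set0; rewrite inE.
have [M mM E] := eq_bigmax_cond (fun M : {set {set T}} => #|M|) c0.
by exists M; rewrite inE in mM; rewrite /maximum_matching mM /matching_number -E eqxx.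
Qed.

Lemma matching_sub G' G M : subgraph G' G -> matching G' M -> matching G M.
Proof.
move=> s /andP[sM tM]; apply/andP; split=> //.
exact: subset_trans sM (sub_edges s).
Qed.

Lemma matching_number_sub G' G : subgraph G' G -> (matching_number G' <= matching_number G)%N.
Proof.
move=> s; have [M /andP[mM /eqP<-]] := maximum_matching_ex G'.
exact/matching_leq/matching_sub/mM.
Qed.

Lemma matching_del G D M : matching (del G D) M = matching G M && [disjoint M & D].
Proof. by rewrite /matching edges_del subsetD andbAC. Qed.

Lemma matching_del_star G X M : matching (del G (star X)) M ->
  matching G M /\ forall e x, e \in M -> x \in X -> x \notin e.
Proof.
rewrite matching_del => /andP[mM d]; split=> // e x eM xX; apply/negP => xe.
by have := disjointFr d eM; rewrite inE => /negbT/negP[]; apply/pred0Pn; exists x; rewrite /= xe.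
Qed.

Lemma matching_star G X M : matching G M ->
  (forall e x, e \in M -> x \in X -> x \notin e) -> matching (del G (star X)) M.
Proof.
move=> mM h; rewrite matching_del mM disjoint_subset; apply/subsetP => e eM.
rewrite !inE negbK disjoint_subset; apply/subsetP => x xe; rewrite inE.
by apply: contraL xe; apply: h.
Qed.

Lemma card_edge G e : e \in edges G -> #|e| = 2%N.
Proof. by case/edgesP=> x [y [xy ->]]; rewrite cards2 (adj_neq xy). Qed.

Lemma matching_card G M X : matching G M -> (forall e, e \in M -> e \subset X) ->
  (2 * #|M| <= #|X|)%N.
Proof.
move=> mM h; have [_ /eqP E] := leq_card_cover M; have /andP[_ tM] := mM.
have -> : (2 * #|M| = #|cover M|)%N.
  have := (leq_card_cover M).2; rewrite tM => /eqP->.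
  rewrite (eq_bigr (fun=> 2%N)) ?sum_nat_const 1?mulnC // => e eM.
  exact/(@card_edge G)/(matching_edges mM).
by apply: subset_leq_card; apply/bigcupsP => e; apply: h.
Qed.

Lemma matching_setU1 G M u v : matching G M -> adj G u v ->
    (forall e, e \in M -> u \notin e) -> (forall e, e \in M -> v \notin e) ->
  matching G ([set u; v] |: M) /\ #|[set u; v] |: M| = #|M|.+1.
Proof.
move=> mM uv uM vM; have [sM tM] := matchingP _ _ mM; split; last first.
  by rewrite cardsU1 (_ : _ \notin M) //; apply/negP => /uM; rewrite set21.
apply/matchingP; split.
  by rewrite subUset sM sub1set in_edges uv.
move=> e f x /setU1P[->|eM] /setU1P[->|fM] //.
- by rewrite !inE => /orP[]/eqP-> h; [case/negP: (uM _ fM)|case/negP: (vM _ fM)].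
- by move=> + /set2P[] xE; rewrite xE => h; [case/negP: (uM _ eM)|case/negP: (vM _ eM)].
exact: tM.
Qed.

Lemma matching_subset G M N : matching G M -> N \subset M -> matching G N.
Proof.
move=> /andP[sM tM] s; apply/andP; split; first exact: subset_trans s sM.
exact: trivIsetS s tM.
Qed.

Lemma pendant_matching_number G u v : adj G u v -> (forall w, adj G u w -> w = v) ->
  ((matching_number (del G (star [set v]))).+1 <= matching_number G)%N.
Proof.
move=> uv pu; have [M /andP[mM /eqP<-]] := maximum_matching_ex (del G (star [set v])).
have [mGM hv] := matching_del_star mM.
have [] := @matching_setU1 _ _ u v mGM uv.
- move=> e eM; apply/negP => ue; have /edgesP[a [b [ab eE]]] := matching_edges mGM eM.
  have := hv _ v eM (set11 v); rewrite eE !inE; move: ue; rewrite eE !inE => /orP[]/eqP uE.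
    by rewrite -uE in ab; rewrite (pu _ ab) eqxx orbT.
  by rewrite -uE adjC in ab; rewrite (pu _ ab) eqxx.
- by move=> e eM; apply: hv eM (set11 v).
by move=> /matching_leq + E; rewrite E.
Qed.

Lemma star_matching_number G v :
  (matching_number G <= (matching_number (del G (star [set v]))).+1)%N.
Proof.
have [M /andP[mM /eqP<-]] := maximum_matching_ex G.
have [sM tM] := matchingP _ _ mM.
rewrite -(cardsID (star [set v]) M) -[X in (_ <= X)%N]add1n leq_add //.
  have st e : (e \in star [set v]) = (v \in e) by rewrite inE disjoint_sym disjoints1 negbK.
  apply/card_le1_eqP => e f; rewrite !in_setI !st.
  by move=> /andP[eM ve] /andP[fM vf]; rewrite (tM e f v).
apply: matching_leq; rewrite matching_del (matching_subset mM) ?subsetDl //.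
by rewrite disjoints_subset; apply/subsetP => e; rewrite in_setD in_setC => /andP[].
Qed.

End Matchings.

(** * Pairings along a cycle and exchange of matchings *)

Section Exchange.

Variable T : finType.
Implicit Types (G : mixedGraph T) (D M N : {set {set T}}) (X R : {set T}).
Implicit Types (x y a b u v : T) (e f : {set T}) (c s : seq T).

Fixpoint pairing s : {set {set T}} :=
  if s is x :: y :: s' then [set x; y] |: pairing s' else set0.

Lemma pairing_ind (P : seq T -> Prop) : P [::] -> (forall x, P [:: x]) ->
  (forall x y s, P s -> P [:: x, y & s]) -> forall s, P s.
Proof.
move=> P0 P1 P2 s; have [n] := ubnP (size s); elim: n s => // n IH [|x [|y s]] //= le.
by apply/P2/IH; rewrite ltnS in le; apply: leq_trans le; rewrite ltnS.
Qed.

Lemma pairing_mem s e x : e \in pairing s -> x \in e -> x \in s.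
Proof.
elim/pairing_ind: s => [||u v s IH] /=; rewrite ?inE //.
move=> /orP[/eqP->|/IH h /h ->]; last by rewrite !orbT.
by rewrite !inE => /orP[]/eqP->; rewrite eqxx ?orbT.
Qed.

Lemma pairing_sorted (r : rel T) s e : sorted r s -> e \in pairing s ->
  exists x y, [/\ x \in s, y \in s, r x y & e = [set x; y]].
Proof.
elim/pairing_ind: s => [||u v s IH] /=; rewrite ?inE // => /andP[uv vs].
case/orP=> [/eqP->|/IH []]; first by exists u, v; rewrite !inE !eqxx ?orbT.
  by case: s vs {IH} => //= w s /andP[].
by move=> x [y [xs ys xy ->]]; exists x, y; rewrite !inE xs ys !orbT.
Qed.

Lemma pairing_matching G s : uniq s -> (forall e, e \in pairing s -> e \in edges G) ->
  matching G (pairing s) /\ #|pairing s| = (size s)./2.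
Proof.
elim/pairing_ind: s => [||u v s IH] /=; try by
  move=> _ _; rewrite cards0; split=> //; apply/matchingP;
  split=> [|e f x]; rewrite ?sub0set // inE.
rewrite inE negb_or => /and3P[/andP[uv us] vs uqs] sE.
have [|mM cM] := IH uqs; first by move=> e eM; apply: sE; rewrite inE eM orbT.
have uvG : adj G u v by rewrite -in_edges sE ?setU11.
have [] := @matching_setU1 _ _ _ u v mM uvG.
- by move=> e eM; apply: contra us; apply: pairing_mem.
- by move=> e eM; apply: contra vs; apply: pairing_mem.
by move=> h1 ->; rewrite cM.
Qed.

Lemma cycle_sorted c (r := [rel x y | [set x; y] \in cycle_edges c]) x s :
  uniq c -> c = x :: s -> sorted r c /\ sorted r s.
Proof.
move=> uc cE; have : cycle r c.
  by apply: cycle_from_next => // y yc /=; apply: next_cycle_edge.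
by rewrite cE /= rcons_path => /andP[pp _]; split=> //; apply: path_sorted pp.
Qed.

Lemma cycle_edges_rot c n : uniq c -> cycle_edges (rot n c) = cycle_edges c.
Proof.
move=> uc; apply/setP => e; apply/cycle_edgesP/cycle_edgesP => -[x xc ->]; exists x.
- by rewrite mem_rot in xc.
- by rewrite next_rot.
- by rewrite mem_rot.
by rewrite next_rot.
Qed.

(** Rotated to begin at [x], the cycle has an even number of further vertices, which are paired in
    order. *)
Lemma cycle_pairing_except G c x : is_cycle G c -> x \in c -> odd (size c) ->
  exists N, [/\ matching G N, #|N| = (size c)./2, N \subset cycle_edges c &
    forall e, e \in N -> x \notin e].
Proof.
move=> cc xc oc; have [c2 uc _] := and3P cc; have [i s rE] := rot_to xc.
have ur : uniq (x :: s) by rewrite -rE rot_uniq.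
have [_ ss] := cycle_sorted ur (erefl _).
have sE e : e \in pairing s -> e \in cycle_edges c.
  move=> /(pairing_sorted ss)[a [b [_ _ /= + ->]]].
  by rewrite -rE cycle_edges_rot.
have /andP[xs us] : (x \notin s) && uniq s by [].
have [|mN cN] := @pairing_matching G s us.
  by move=> e /sE; apply/subsetP/is_cycle_edges.
exists (pairing s); split=> //.
- have := size_rot i c; rewrite rE /= => sz; rewrite cN -sz.
  by move: oc; rewrite -sz /= uphalf_half => /negbTE->.
- exact/subsetP.
by move=> e eN; apply: contra xs; apply: pairing_mem.
Qed.

Lemma cycle_pairing_even G c : is_cycle G c -> ~~ odd (size c) ->
  exists N, [/\ matching G N, (2 * #|N| = size c)%N & N \subset cycle_edges c].
Proof.
move=> cc ec; have [c2 uc _] := and3P cc.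
case cE : c c2 => [|x s] // _; have [ss _] := cycle_sorted uc cE.
have sE e : e \in pairing c -> e \in cycle_edges c.
  by move=> /(pairing_sorted ss)[a [b [_ _ /= + ->]]].
have [|mN cN] := @pairing_matching G c uc.
  by move=> e /sE; apply/subsetP/is_cycle_edges.
exists (pairing c); rewrite -cE; split=> //; last exact/subsetP.
by rewrite cN mul2n; move: ec; lia.
Qed.

Definition inside R M := [set e in M | e \subset R].

(** Edges of [M] not contained in [R] are kept, so a clash can only occur at a vertex of [R] between
    such an edge and the part taken from [N]; the hypothesis excludes it. The count is written
    additively to avoid truncated subtraction. *)
Lemma matching_switch G R M N :
    matching G M -> matching G N ->
    (forall e f x, e \in M -> ~~ (e \subset R) -> x \in e -> x \in R ->
       f \in N -> f \subset R -> x \notin f) ->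
  matching G (M :\: inside R M :|: inside R N) /\
  (#|M :\: inside R M :|: inside R N| + #|inside R M| = #|M| + #|inside R N|)%N.
Proof.
move=> mM mN h; have [sM tM] := matchingP _ _ mM; have [sN tN] := matchingP _ _ mN.
have inM e : (e \in M :\: inside R M) = (e \in M) && ~~ (e \subset R).
  by rewrite !inE; case: (e \in M); rewrite ?andbF ?andbT.
have inN e : (e \in inside R N) = (e \in N) && (e \subset R) by rewrite inE.
split; last first.
  rewrite cardsU (_ : _ :&: _ = set0) ?cards0 ?subn0; last first.
    by apply/setP => e; rewrite in_setI inM inN in_set0; case: (e \subset R); rewrite ?andbF.
  rewrite addnAC cardsD (setIidPr _) ?subnK //.
    by apply: subset_leq_card; apply/subsetP => e; rewrite inE => /andP[].
  by apply/subsetP => e; rewrite inE => /andP[].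
apply/matchingP; split.
  rewrite subUset (subset_trans (subsetDl _ _) sM) (subset_trans _ sN) //.
  by apply/subsetP => e; rewrite inN => /andP[].
have aux e f x : e \in M -> ~~ (e \subset R) -> f \in N -> f \subset R ->
    x \in e -> x \in f -> False.
  move=> eM eR fN fR xe xf; have xR : x \in R := subsetP fR _ xf.
  by have := h _ _ _ eM eR xe xR fN fR; rewrite xf.
move=> e f x; rewrite ![_ \in _ :|: _]in_setU !inM !inN.
move=> /orP[]/andP[eM eR] /orP[]/andP[fM fR] xe xf.
- exact: tM eM fM xe xf.
- by case: (aux e f x).
- by case: (aux f e x).
- exact: tN eM fM xe xf.
Qed.

(* Distinct vertices of the cycle lie in distinct components of G - E(c).  In
   the component of [a], the edges of N are traded for those of [F a]: this
   cannot lose edges, since trading them the other way keeps [F a] a matching. *)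
Lemma glue_matchings G c (F : T -> {set {set T}}) N :
    cycles_disjoint G -> is_cycle G c ->
    (forall a, a \in c -> maximum_matching G (F a) /\ forall e, e \in F a -> a \notin e) ->
    matching G N ->
  exists N', [/\ matching G N', (#|N| <= #|N'|)%N,
    {in cycle_edges c, N' =i N},
    (forall e, e \in N' -> e \in N \/ exists2 a, a \in c & e \in F a) &
    forall e x, e \in N' -> e \notin cycle_edges c -> x \in c -> x \notin e].
Proof.
move=> dG cc hF mN; set E := cycle_edges c.
pose G1 := del G E.
pose R a := [set w | connect (adj G1) a w].
(* The component [R a] meets the cycle in [a] only, so exchanges inside it never touch cycle
   edges. *)
have R_cyc a e : a \in c -> e \in E -> ~~ (e \subset R a).
  move=> ac /cycle_edgesP[y yc ->]; apply/negP; rewrite subUset !sub1set !inE => /andP[ay an].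
  have nc : next c y \in c by rewrite mem_next.
  have /and3P[_ _ /next_cycle/(_ yc)] := cc.
  rewrite -(cycles_disjoint_separated dG cc ac nc an).
  by rewrite -(cycles_disjoint_separated dG cc ac yc ay) adj_irr.
have R_ncyc a e x : e \in edges G -> e \notin E -> x \in e -> x \in R a -> e \subset R a.
  move=> /edgesP[u [v [uv ->]]] ne xe; rewrite inE => ax.
  have uv1 : adj G1 u v by rewrite /= /del_adj uv.
  have [au av] : connect (adj G1) a u /\ connect (adj G1) a v.
    move: xe; rewrite !inE => /orP[]/eqP xE; rewrite xE in ax; split=> //.
      exact: connect_trans ax (connect1 uv1).
    by apply: connect_trans ax _; rewrite connC connect1.
  by rewrite subUset !sub1set !inE au av.
(* An edge that meets [R a] without being contained in it is a cycle edge, hence meets it at [a],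
   the vertex that [F a] leaves free. *)
have R_touch a e x : a \in c -> e \in edges G -> ~~ (e \subset R a) ->
    x \in e -> x \in R a -> x = a.
  move=> ac eG neR xe xR; have [eE|neE] := boolP (e \in E); last first.
    by rewrite (R_ncyc a e x) in neR.
  apply/esym; apply: (cycles_disjoint_separated dG cc ac); last by rewrite inE in xR.
  have /cycle_edgesP[y yc eE'] := eE.
  by move: xe; rewrite eE' !inE => /orP[]/eqP->; rewrite ?mem_next.
suff H s : {subset s <= c} -> exists N', [/\ matching G N', (#|N| <= #|N'|)%N,
    {in E, N' =i N},
    (forall e, e \in N' -> e \in N \/ exists2 a, a \in c & e \in F a) &
    forall e x, e \in N' -> e \notin E -> x \in s -> x \notin e].
  exact: H.
elim: s => [_|a s IH sc]; first by exists N; split=> // e; left.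
have [|N1 [mN1 le1 eE1 or1 av1]] := IH; first by move=> x xs; apply: sc; rewrite inE xs orbT.
have ac : a \in c by apply: sc; rewrite mem_head.
have [/andP[mF /eqP cF] aF] := hF a ac.
have Ra b : b \in c -> b \in R a -> b = a.
  by move=> bc; rewrite inE => /(cycles_disjoint_separated dG cc ac bc).
have [e f x eN eR xe xR fF fR|mN2 cN2] := @matching_switch G (R a) N1 (F a) mN1 mF.
  by rewrite (R_touch a e x ac (matching_edges mN1 eN) eR xe xR) aF.
have [e f x eF eR xe xR fN fR|mF2 cF2] := @matching_switch G (R a) (F a) N1 mF mN1.
  have xa := R_touch a e x ac (matching_edges mF eF) eR xe xR.
  by have := aF e eF; rewrite -xa xe.
have leF : (#|inside (R a) N1| <= #|inside (R a) (F a)|)%N.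
  have := matching_leq mF2; move: cF2; rewrite cF.
  by move: (#|_|) (#|inside _ _|) (#|inside _ _|) (matching_number G) => p q r t; lia.
set N2 := _ :|: _ in mN2 cN2.
have inN2 e : (e \in N2) = ((e \in N1) && ~~ (e \subset R a)) || ((e \in F a) && (e \subset R a)).
  by rewrite !inE; case: (e \in N1); rewrite ?andbF ?andbT.
exists N2; split=> //.
- apply: leq_trans le1 _; move: cN2 leF.
  by move: (#|N2|) (#|N1|) (#|inside _ _|) (#|inside _ _|) => p q r t; lia.
- move=> e eE; rewrite -eE1 // inN2 (negPf (R_cyc a e ac eE)) andbF orbF.
  by rewrite andbT.
- move=> e; rewrite inN2 => /orP[]/andP[h _]; first exact: or1.
  by right; exists a.
move=> e x; rewrite inN2 => /orP[/andP[eN eR]|/andP[eF eR]] eE; rewrite inE.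
  case/orP=> [/eqP->|xs]; last exact: av1.
  apply: contra eR => ae; apply: (R_ncyc a e a) => //; first exact: matching_edges mN1 eN.
  by rewrite inE connect0.
(* An edge taken from [F a] lies in [R a], whose only cycle vertex is [a]; it cannot spoil the
   vertices treated before. *)
move=> xs; apply/negP => xe; have xc : x \in c by apply: sc; rewrite inE.
by have := aF e eF; rewrite -(Ra x xc (subsetP eR _ xe)) xe.
Qed.

End Exchange.

(** * Maximum matchings that avoid the edges leaving cycles *)

Section Avoidance.

Variable T : finType.
Implicit Types (G : mixedGraph T) (D M N : {set {set T}}) (X R : {set T}).
Implicit Types (x y a b u v : T) (e f : {set T}) (c s : seq T).

Definition avoids G M := forall e, e \in M -> ~ leaves_cycle G e.

Lemma leaves_cycle_sub G' G e : subgraph G' G -> leaves_cycle G' e -> leaves_cycle G e.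
Proof.
move=> s [c [x [y [cc xc yc xy eE]]]]; exists c, x, y; split=> //; last exact: s.
exact: is_cycle_sub cc.
Qed.

Lemma avoids_sub G' G M : subgraph G' G -> avoids G M -> avoids G' M.
Proof. by move=> s h e eM /(leaves_cycle_sub s); apply: h. Qed.

Lemma cycle_edge_not_leaves G c e : cycles_disjoint G -> is_cycle G c ->
  e \in cycle_edges c -> ~ leaves_cycle G e.
Proof.
move=> dG cc ec [c' [x [y [cc' xc' yc' _ eE]]]].
move: ec; rewrite eE => ec; have [xc _ _] := cycle_edge_mem ec.
move: ec; rewrite (cycles_disjoint_edges dG cc cc' xc xc') => /cycle_edge_mem[_ yc _].
by rewrite yc in yc'.
Qed.

Lemma avoids_cycle G c M e x : cycles_disjoint G -> is_cycle G c -> matching G M ->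
  avoids G M -> e \in M -> e \notin cycle_edges c -> x \in c -> x \notin e.
Proof.
move=> dG cc mM av eM ne xc; apply/negP => xe.
have [y [xy eE]] : exists y, adj G x y /\ e = [set x; y].
  have /edgesP[u [v [uv eE]]] := matching_edges mM eM.
  move: xe; rewrite eE !inE => /orP[]/eqP->; first by exists v.
  by exists u; rewrite adjC setUC.
have [yc|yc] := boolP (y \in c).
  by case/negP: ne; rewrite eE; apply: (cycles_disjoint_chordless dG cc).
by apply: (av e eM); exists c, x, y.
Qed.

Lemma matching_setU_cycle G c M N : matching G M -> matching G N ->
    (forall e x, e \in M -> x \in c -> x \notin e) -> N \subset cycle_edges c ->
  matching G (M :|: N) /\ #|M :|: N| = (#|M| + #|N|)%N.
Proof.
move=> mM mN Mc /subsetP Nc; have [sM tM] := matchingP _ _ mM; have [sN tN] := matchingP _ _ mN.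
have Nc' e x : e \in N -> x \in e -> x \in c.
  by move=> /Nc/cycle_edgesP[y yc ->]; rewrite !inE => /orP[]/eqP->; rewrite ?mem_next.
have aux e f x : e \in M -> f \in N -> x \in e -> x \in f -> False.
  by move=> eM fN xe xf; have := Mc e x eM (Nc' f x fN xf); rewrite xe.
split; last first.
  rewrite cardsU (_ : M :&: N = set0) ?cards0 ?subn0 //.
  apply/setP => e; rewrite in_setI in_set0; apply/negP => /andP[eM eN].
  have /Nc/cycle_edgesP[y yc eE] := eN.
  by apply: (aux e e y) => //; rewrite eE set21.
apply/matchingP; split; first by rewrite subUset sM.
move=> e f x; rewrite !in_setU => /orP[]eM /orP[]fM xe xf.
- exact: tM eM fM xe xf.
- by case: (aux e f x).
- by case: (aux f e x).
exact: tN eM fM xe xf.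
Qed.

Lemma matching_cycle_card G c M : matching G M ->
  (2 * #|M :&: cycle_edges c| <= size c)%N.
Proof.
move=> mM; apply: leq_trans (card_size c).
have mI : matching G (M :&: cycle_edges c) by apply: matching_subset mM _; apply: subsetIl.
have -> : #|c| = #|[set x in c]| by rewrite cardsE.
apply: (matching_card mI).
move=> e /setIP[_ /cycle_edgesP[y yc ->]].
by rewrite subUset !sub1set !inE mem_next yc.
Qed.

(** For odd length q, [M] has at most (q-1)/2 edges on the cycle, and its other edges do not touch
    [c]. Exchanging the former for a pairing of exactly that size shows, by maximality, that the
    bound is attained. *)
Lemma matching_cut_card G c M : cycles_disjoint G -> is_cycle G c -> odd (size c) ->
  maximum_matching G M -> avoids G M ->
  #|M| = (#|M :\: cycle_edges c| + (size c)./2)%N.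
Proof.
move=> dG cc oc /andP[mM /eqP cM] av.
have [x xc] : exists x, x \in c by case: c {cc} oc => // x s; exists x; rewrite mem_head.
have [N [mN cN Nc _]] := cycle_pairing_except cc xc oc.
have mD : matching G (M :\: cycle_edges c) by apply: matching_subset mM _; apply: subsetDl.
have [] := @matching_setU_cycle G c (M :\: cycle_edges c) N mD mN _ Nc.
  by move=> e y /setDP[eM ne]; exact: (avoids_cycle dG cc mM av eM ne).
move=> /matching_leq le E.
have := matching_cycle_card c mM; have := cardsID (cycle_edges c) M.
by move: le; rewrite E cN -cM; move: (#|_ :\: _|) (#|_ :&: _|) (#|M|) => p q r; lia.
Qed.

(** The edges of [M] on an odd cycle may be replaced, without loss, by the pairing that leaves out
    any prescribed vertex. *)
Lemma maximum_matching_expose G c M x : cycles_disjoint G -> is_cycle G c ->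
    odd (size c) -> maximum_matching G M -> avoids G M -> x \in c ->
  exists M', [/\ maximum_matching G M', avoids G M' & forall e, e \in M' -> x \notin e].
Proof.
move=> dG cc oc MM av xc; have /andP[mM /eqP cM] := MM.
have [N [mN cN Nc Nx]] := cycle_pairing_except cc xc oc.
have mD : matching G (M :\: cycle_edges c) by apply: matching_subset mM _; apply: subsetDl.
have Mc e y : e \in M :\: cycle_edges c -> y \in c -> y \notin e.
  by move=> /setDP[eM ne]; exact: (avoids_cycle dG cc mM av eM ne).
have [mU cU] := @matching_setU_cycle G c (M :\: cycle_edges c) N mD mN Mc Nc.
exists (M :\: cycle_edges c :|: N); split.
- by rewrite /maximum_matching mU -cM cU cN -(matching_cut_card dG cc oc MM av) eqxx.
- move=> e /setUP[/setDP[eM _]|eN]; first exact: av.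
  exact: cycle_edge_not_leaves dG cc (subsetP Nc _ eN).
by move=> e /setUP[eM|]; [apply: Mc|apply: Nx].
Qed.

Lemma maximum_matching_star G M x : maximum_matching G M ->
    (forall e, e \in M -> x \notin e) ->
  maximum_matching (del G (star [set x])) M /\
  matching_number (del G (star [set x])) = matching_number G.
Proof.
move=> /andP[mM /eqP cM] Mx.
have m' : matching (del G (star [set x])) M.
  by apply: matching_star => // e y eM /set1P->; apply: Mx.
have E : matching_number (del G (star [set x])) = matching_number G.
  apply/eqP; rewrite eqn_leq matching_number_sub; last exact: del_sub.
  by rewrite -cM matching_leq.
by rewrite /maximum_matching m' E cM eqxx.
Qed.

(** Gluing onto a maximum matching without cycle edges gives one at least as large, still without
    cycle edges, that misses all of [c]. *)
Lemma cut_cycle_matching_number G c (F : T -> {set {set T}}) :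
    cycles_disjoint G -> is_cycle G c ->
    (forall a, a \in c -> maximum_matching G (F a) /\ forall e, e \in F a -> a \notin e) ->
  matching_number (del (del G (cycle_edges c)) (star [set x in c])) =
  matching_number (del G (cycle_edges c)).
Proof.
move=> dG cc hF; apply/eqP; rewrite eqn_leq matching_number_sub /=; last exact: del_sub.
have [N /andP[+ /eqP<-]] := maximum_matching_ex (del G (cycle_edges c)).
rewrite matching_del => /andP[mN dN].
have [N' [mN' le eN _ av]] := glue_matchings dG cc hF mN.
apply: leq_trans le _; apply: matching_leq.
have ne e : e \in N' -> e \notin cycle_edges c.
  move=> eN'; apply/negP => ec; move: eN'; rewrite eN // => eN'.
  by rewrite (disjointFr dN eN') in ec.
apply: matching_star.
  by rewrite matching_del mN' disjoint_subset; apply/subsetP => e /ne.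
by move=> e x eN'; rewrite inE => xc; apply: av => //; apply: ne.
Qed.

(** A matching of [G2] misses [c] and can be enlarged by (q-1)/2 cycle edges; comparison with
    [matching_cut_card] for [M] bounds it by the size of [M0]. Exposing each vertex of [c] supplies
    the family showing that [G1] and [G2] have the same matching number. *)
Lemma maximum_matching_cut G c M : cycles_disjoint G -> is_cycle G c ->
    odd (size c) -> maximum_matching G M -> avoids G M ->
  let G1 := del G (cycle_edges c) in let G2 := del G1 (star [set x in c]) in
  let M0 := M :\: cycle_edges c in
  [/\ maximum_matching G1 M0, maximum_matching G2 M0 & matching_number G1 = matching_number G2].
Proof.
move=> dG cc oc MM av G1 G2 M0; have /andP[mM /eqP cM] := MM.
have ex a : a \in c -> exists M',
    [/\ maximum_matching G M', avoids G M' & forall e, e \in M' -> a \notin e].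
  exact: maximum_matching_expose MM av.
have E : matching_number G2 = matching_number G1.
  pose F a := odflt set0 [pick M' | maximum_matching G M' && [forall (e | e \in M'), a \notin e]].
  apply: (@cut_cycle_matching_number _ _ F dG cc) => a ac; rewrite /F.
  case: pickP => [M' /andP[mM' /forall_inP h]|h] //=.
  have [M' [m1 _ m2]] := ex a ac; have := h M'; rewrite m1 /=.
  by move=> /negbT/forall_inP[].
have m1 : matching G1 M0.
  rewrite matching_del (matching_subset mM) ?subsetDl //.
  by rewrite disjoint_subset; apply/subsetP => e /setDP[].
have m2 : matching G2 M0.
  apply: matching_star => // e x /setDP[eM ne]; rewrite inE.
  exact: (avoids_cycle dG cc mM av eM ne).
have c2 : #|M0| = matching_number G2.
  apply/eqP; rewrite eqn_leq matching_leq //=.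
  have [N /andP[mN /eqP<-]] := maximum_matching_ex G2.
  have [mN1 Nc] := matching_del_star mN.
  have mN0 := matching_sub (@del_sub _ _ _) mN1.
  have [x xc] : exists x, x \in c by case: (c) oc => // x s; exists x; rewrite mem_head.
  have [P [mP cP Pc _]] := cycle_pairing_except cc xc oc.
  have [] := @matching_setU_cycle G c N P mN0 mP _ Pc.
    by move=> e y eN yc; apply: Nc eN _; rewrite inE.
  move=> /matching_leq + cU; rewrite cU cP -cM (matching_cut_card dG cc oc MM av).
  by rewrite leq_add2r.
by split; rewrite /maximum_matching ?m1 ?m2 ?c2 ?E /=.
Qed.

(** A glued edge cannot leave [c], whose vertices meet cycle edges only. If it comes from [F a] and
    leaves another cycle, that cycle misses [a] and survives in G - a, where [F a] avoids such
    edges. On [c] the edges are those of [F x], so [x] stays free. *)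
Lemma maximum_matching_glue G c (F : T -> {set {set T}}) x :
    cycles_disjoint G -> is_cycle G c ->
    (forall a, a \in c -> [/\ maximum_matching G (F a), 
       avoids (del G (star [set a])) (F a) & forall e, e \in F a -> a \notin e]) ->
    x \in c ->
  exists M, [/\ maximum_matching G M, avoids G M & forall e, e \in M -> x \notin e].
Proof.
move=> dG cc hF xc.
have [/andP[mN /eqP cN] avN Nx] := hF x xc.
have [|M [mM le eE or av]] := @glue_matchings _ G c F (F x) dG cc _ mN.
  by move=> a ac; have [] := hF a ac.
exists M; split.
- by rewrite /maximum_matching mM eqn_leq matching_leq //= -cN.
- move=> e eM [c' [u [v [cc' uc' vc' uv eE']]]].
  have [a ac eF] : exists2 a, a \in c & e \in F a by case: (or e eM) => // h; exists x.
  have [_ avF Fa] := hF a ac; have ae := Fa e eF.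
  have ac' : a \notin c'.
    apply/negP => ac'; have EE := cycles_disjoint_edges dG cc cc' ac ac'.
    have uc : u \in c by apply: cycle_edges_mem uc'; rewrite EE.
    have : u \notin e.
      apply: av eM _ uc; rewrite EE eE'; apply/negP => /cycle_edge_mem[_ h _].
      by rewrite h in vc'.
    by rewrite eE' set21.
  apply: (avF e eF); exists c', u, v; split=> //.
    by apply: is_cycle_star => // y yc'; rewrite inE; apply: contraNneq ac' => <-.
  rewrite adj_del_star uv !inE /=; move: ae; rewrite eE' !inE negb_or.
  by rewrite !(eq_sym a).
move=> e eM; apply/negP => xe; have [ec|ne] := boolP (e \in cycle_edges c).
  by move: eM; rewrite eE // => /Nx; rewrite xe.
by have := av e x eM ne xc; rewrite xe.
Qed.

(** On an even cycle of length q, [M] would have fewer than q/2 edges because it misses [x], and a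
    perfect matching of the cycle would do better. *)
Lemma exposed_cycle_odd G c M x : cycles_disjoint G -> is_cycle G c -> x \in c ->
    maximum_matching G M -> avoids G M -> (forall e, e \in M -> x \notin e) ->
  odd (size c).
Proof.
move=> dG cc xc /andP[mM /eqP cM] av Mx; apply/negPn/negP => ec.
have [N [mN cN Nc]] := cycle_pairing_even cc ec.
have mD : matching G (M :\: cycle_edges c) by apply: matching_subset mM _; apply: subsetDl.
have [] := @matching_setU_cycle G c (M :\: cycle_edges c) N mD mN _ Nc.
  by move=> e y /setDP[eM ne]; exact: (avoids_cycle dG cc mM av eM ne).
move=> /matching_leq le E.
have mI : matching G (M :&: cycle_edges c) by apply: matching_subset mM _; apply: subsetIl.
have := @matching_card _ G _ ([set y in c] :\ x) mI; have := cardsD1 x [set y in c].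
rewrite inE xc cardsE; have /and3P[_ /card_uniqP-> _] := cc => sz le2.
have {}le2 : (2 * #|M :&: cycle_edges c| <= #|[set y in c] :\ x|)%N.
  apply: le2 => e /setIP[eM /cycle_edgesP[y yc eE]].
  rewrite subsetD1 (Mx e eM) andbT eE.
  by rewrite subUset !sub1set !inE mem_next yc.
have := cardsID (cycle_edges c) M.
move: le le2 sz cN; rewrite E -cM.
by move: (#|_ :\: _|) (#|_ :&: _|) (#|M|) (#|_ :\ _|) (#|N|) => p q r t n; lia.
Qed.

End Avoidance.

(** * The weight of an odd cycle *)

Section CycleVector.

Variables (C : numClosedFieldType) (T : finType) (G : mixedGraph T).
Variables (x0 : T) (s : seq T).
Local Notation c := (x0 :: s).
Local Notation q := (size c).
Local Notation h := (hentry G C).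
Hypotheses (cc : is_cycle G c) (oc : odd q).

Let n j := nth x0 c j.
Let H j := h (n j) (n j.+1).
Let W j := \prod_(i < j) H i.
Let w := W q.

Definition cycle_weight : C := \prod_(x <- c) h x (next c x).

Let uc : uniq c. Proof. by case/and3P: cc. Qed.
Let q3 : (2 < q)%N. Proof. by case/and3P: cc. Qed.

Let next_n j : (j < q)%N -> next c (n j) = n j.+1.
Proof. by move=> jq; rewrite next_nth mem_nth // index_uniq. Qed.

Let n_mem j : (j < q)%N -> n j \in c. Proof. exact: mem_nth. Qed.

(* Out of range, [nth] returns [x0], so [n] closes up at [q]. *)
Let nq : n q = x0. Proof. by rewrite /n nth_default. Qed.

Let adj_n j : (j < q)%N -> adj G (n j) (n j.+1).
Proof.
move=> jq; rewrite -next_n //; apply: next_cycle (n_mem jq).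
by case/and3P: cc.
Qed.

Lemma hentry_unit x y : adj G x y -> h x y * (h x y)^* = 1.
Proof.
move=> xy; rewrite /hentry xy; case: ifP => _; first by rewrite -normCK normCi expr1n.
case: ifP => _; last by rewrite conjC1 mulr1.
by rewrite -normCK normrN normCi expr1n.
Qed.

Let HH j : (j < q)%N -> H j * (H j)^* = 1.
Proof. by move=> jq; apply/hentry_unit/adj_n. Qed.

Let WS j : W j.+1 = W j * H j. Proof. by rewrite /W big_ord_recr. Qed.

Let WW j : (j <= q)%N -> W j * (W j)^* = 1.
Proof.
elim: j => [|j IH] jq; first by rewrite /W big_ord0 conjC1 mulr1.
by rewrite WS rmorphM /= mulrACA IH ?HH ?mulr1 // ltnW.
Qed.

Let wE : w = cycle_weight.
Proof.
rewrite /w /W /cycle_weight (big_nth x0) big_mkord; apply: eq_bigr => i _.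
by rewrite -[nth _ _ _]/(n i) next_n.
Qed.

(* The equation of row j gives z_(j+1) = - z_(j-1) h_(j-1,j) h_(j,j+1).  Solve it
   upwards from z_0 = 1 for even j, downwards from z_q = 1 for odd j. *)
Let Z j : C := if odd j then (-1) ^+ (q - j)./2 * w^* * W j else (-1) ^+ j./2 * W j.

Definition cycle_vector u : C := if u \in c then Z (index u c) else 0.

Let z_n j : (j <= q)%N -> cycle_vector (n j) = Z j.
Proof.
rewrite leq_eqVlt => /orP[/eqP->|jq]; last by rewrite /cycle_vector n_mem // index_uniq.
rewrite nq /cycle_vector mem_head [index _ _]/= eqxx /Z oc subnn /=.
by rewrite mul1r mul1r [in LHS]/W big_ord0 mulrC WW.
Qed.

Lemma cycle_vector_head : cycle_vector x0 = 1.
Proof. by rewrite -[x0]/(n 0) z_n // /Z /= mul1r /W big_ord0. Qed.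

Definition cycle_entry u v : C := if [set u; v] \in cycle_edges c then h u v else 0.

Let n_inj i j : (i < q)%N -> (j < q)%N -> n i = n j -> i = j.
Proof. by move=> iq jq /eqP; rewrite nth_uniq // => /eqP. Qed.

Let next_nS j : (j < q)%N ->
  next c (n j.+1) = if (j.+1 < q)%N then n j.+2 else n 1.
Proof.
move=> jq; case: ltnP => jq'; first by rewrite next_n.
have -> : j.+1 = q by apply/eqP; rewrite eqn_leq; apply/andP; split.
by rewrite nq -[x0]/(n 0) next_n.
Qed.

(** The two neighbours on the cycle differ because its length is at least 3; this keeps the two
    terms of [cycle_entry_sum] apart. *)
Let next_neq j : (j < q)%N -> next c (n j.+1) != n j.
Proof.
move=> jq; rewrite next_nS //; apply/eqP; case: ltnP => jq'.
  have [lt|ge] := ltnP j.+2 q; first by move/n_inj => /(_ lt jq); lia.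
  have e : j.+2 = q by apply/eqP; rewrite eqn_leq; apply/andP; split.
  by rewrite e nq -[x0]/(n 0) => /n_inj => /(_ isT jq) j0; move: q3; rewrite -e -j0.
by move/n_inj => /(_ (ltnW q3) jq) j1; move: q3 jq'; rewrite -j1 ltnNge => /negP.
Qed.

Let cycle_entry_sum (z : T -> C) j : (j < q)%N ->
  \sum_u z u * cycle_entry u (n j.+1) =
  z (n j) * H j + z (next c (n j.+1)) * h (next c (n j.+1)) (n j.+1).
Proof.
move=> jq; set y := n j.+1.
have yE : next c (n j) = y := next_n jq.
have yc : y \in c by rewrite -yE mem_next n_mem.
have e1 : [set n j; y] \in cycle_edges c by rewrite -yE next_cycle_edge ?n_mem.
have e2 : [set next c y; y] \in cycle_edges c by rewrite setUC next_cycle_edge.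
rewrite (bigD1 (n j)) //= (bigD1 (next c y)) /=; last exact: next_neq.
rewrite big1 ?addr0 => [|u /andP[uj un]]; first by rewrite /cycle_entry e1 e2.
rewrite /cycle_entry; case: ifP => [/cycle_edge_mem[uc' _ [yu|uy]]|_]; last exact: mulr0.
  case/eqP: uj; have := prev_next uc u; rewrite -yu -yE prev_next //.
by case/eqP: un.
Qed.

Let signS k : (-1) ^+ k.+1 = - (-1) ^+ k :> C. Proof. by rewrite exprS mulN1r. Qed.

Lemma cycle_vectorP y :
  \sum_u cycle_vector u * cycle_entry u y =
  ((-1) ^+ q./2 * (cycle_weight + cycle_weight^*)) * (y == x0)%:R.
Proof.
rewrite -wE; have [yc|yc] := boolP (y \in c); last first.
  rewrite (negPf (_ : y != x0)) ?mulr0 ?big1 // => [u _|]; last first.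
    by apply: contraNneq yc => ->; rewrite mem_head.
  rewrite /cycle_entry; case: ifP => [/cycle_edge_mem[_ yc' _]|_]; last exact: mulr0.
  by rewrite yc' in yc.
(* Indices run from 1 to q here, so that [x0] is [n q] and the predecessor always has index [j]. *)
have [j jq yE] : exists2 j, (j < q)%N & y = n j.+1.
  have pc : prev c y \in c by rewrite mem_prev.
  exists (index (prev c y) c); first by rewrite index_mem.
  by rewrite -next_n ?index_mem // /n nth_index // next_prev.
rewrite yE cycle_entry_sum // next_nS //; have [jq'|jq'] := ltnP j.+1 q.
  have -> : n j.+1 == x0 = false.
    by apply/negP => /eqP; rewrite -[x0]/(n 0) => /n_inj => /(_ jq' isT).
  rewrite mulr0 !z_n ?(ltnW jq) // /Z /= negbK.
  have e1 : h (n j.+2) (n j.+1) = (H j.+1)^* by rewrite hentry_herm.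
  have e2 : W j.+2 * (H j.+1)^* = W j * H j by rewrite WS -mulrA HH // mulr1 WS.
  case: (odd j).
    rewrite -!mulrA e1 e2 !mulrA -!mulrDl (_ : (q - j)./2 = (q - j.+2)./2.+1).
      by rewrite signS addNr !mul0r.
    by move: jq jq'; rewrite /=; lia.
  by rewrite -!mulrA e1 e2 !mulrA -!mulrDl /= signS subrr !mul0r.
(* At [x0] the two chains meet: the even one arrives from q-1 with w, the odd one from 1 with the
   conjugate of w, both with the sign (-1)^((q-1)/2). *)
have jE : j.+1 = q by apply/eqP; rewrite eqn_leq; apply/andP; split.
have ev : odd j = false by move: oc; rewrite -jE /= => /negbTE.
rewrite jE nq eqxx mulr1 !z_n ?(ltnW jq) ?(ltnW (ltnW q3)) // /Z ev [odd 1]/=.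
have -> : h (n 1) x0 = (H 0)^* by rewrite hentry_herm.
have -> : W 1 = H 0 by rewrite /W big_ord1.
rewrite -[_ * _ * H 0 * _]mulrA HH // mulr1 -mulrA -WS jE -/w mulrDr.
by congr (_ ^+ _ * _ + _ ^+ _ * _); move: oc; rewrite -jE /=; lia.
Qed.

Lemma hentry_arc x y : adj G x y -> h x y = 'i ^+ Defs.arc G x y * (- 'i) ^+ Defs.arc G y x.
Proof.
move=> xy; rewrite /hentry xy; case: ifP => [/arc_asym/negPf->|_].
  by rewrite expr0 mulr1.
by case: ifP; rewrite ?expr0 !mul1r.
Qed.

Lemma cycle_weightE :
  cycle_weight = 'i ^+ forward_arcs G c * (- 'i) ^+ backward_arcs G c.
Proof.
rewrite /cycle_weight /forward_arcs /backward_arcs.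
have: forall x, x \in c -> adj G x (next c x).
  by move=> x; apply: next_cycle; case/and3P: cc.
move: (next c) => nx; elim: c => [|x t IH] hx.
  by rewrite big_nil !expr0 mulr1.
rewrite big_cons IH; last by move=> y yt; apply: hx; rewrite inE yt orbT.
by rewrite hentry_arc ?hx ?mem_head //= !exprD mulrACA.
Qed.

Lemma signature_leq : (signature G c <= q)%N.
Proof.
apply: (@leq_trans (forward_arcs G c + backward_arcs G c)); first by rewrite /signature; lia.
rewrite /forward_arcs /backward_arcs; move: (next c) => nx; elim: c => //= x t IH.
rewrite addnACA -add1n leq_add //.
by case: (boolP (Defs.arc G x _)) => [/arc_asym/negPf->|_] //; case: Defs.arc.
Qed.

(** Since i and -i are inverse to each other, opposite arcs cancel and the weight is i^S or (-i)^S,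
    with S the signature; adding the conjugate gives i^S + (-i)^S. *)
Lemma cycle_weight_real :
  cycle_weight + cycle_weight^* =
  if odd (signature G c) then 0 else 2 * (-1) ^+ (signature G c)./2.
Proof.
have iE : forall k, 'i ^+ k + (- 'i) ^+ k = if odd k then 0 else 2 * (-1) ^+ k./2 :> C.
  move=> k; rewrite -[in LHS](odd_double_half k); set t := k./2.
  have e1 : 'i ^+ t.*2 = (-1) ^+ t :> C by rewrite -mul2n exprM sqrCi.
  have e2 : (- 'i) ^+ t.*2 = (-1) ^+ t :> C by rewrite -mul2n exprM sqrrN sqrCi.
  rewrite !exprD e1 e2 -mulrDl; case: (odd k) => /=; first by rewrite !expr1 subrr mul0r.
  by rewrite !expr0 -(natrD _ 1 1).
rewrite -iE cycle_weightE rmorphM !rmorphXn /= rmorphN /= conjCi opprK /signature.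
move: (forward_arcs G c) (backward_arcs G c) => f b.
have iN : 'i * - 'i = 1 :> C by rewrite mulrN -expr2 sqrCi opprK.
have [le|/ltnW le] := leqP b f.
  have -> : absz (f%:Z - b%:Z) = (f - b)%N by lia.
  rewrite -{1 2}(subnK le) !exprD -!mulrA -!exprMn iN [- 'i * _]mulrC iN.
  by rewrite !expr1n !mulr1.
have -> : absz (f%:Z - b%:Z) = (b - f)%N by lia.
rewrite -{1 2}(subnK le) !exprD !mulrA ![_ ^+ f * _]mulrC -!mulrA -!exprMn iN [- 'i * _]mulrC iN.
by rewrite !expr1n !mulr1 addrC.
Qed.

(** For even signature S, l = 2 (-1)^((q-1)/2 + S/2), which is positive iff 4 divides q - 1 + S; as
    4 divides 2S, this says q - S = 1 mod 4. The first part is recorded because the order on [C] is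
    partial. *)
Lemma cycle_eigenvalue_gt0 (l := (-1) ^+ q./2 * (cycle_weight + cycle_weight^*)) :
  (l <= 0 \/ 0 < l) /\ (0 < l <->
    ~~ odd (signature G c) /\
    (absz ((signature G c)%:Z - q%:Z)%R = 1 %[mod 4])%N).
Proof.
rewrite {}/l cycle_weight_real; have := signature_leq; move: oc.
move: (signature G c) (size c) => S Q oQ le.
case: (boolP (odd S)) => oS; first by rewrite mulr0 lexx ltxx; split; [left|split=> // -[]].
have -> : (-1) ^+ Q./2 * (2 * (-1) ^+ S./2) = 2 * (-1) ^+ (odd (Q./2 + S./2)) :> C.
  by rewrite signr_odd exprD mulrCA.
have -> : absz (S%:Z - Q%:Z) = (Q - S)%N by lia.
have e : odd (Q./2 + S./2) = ((Q - S) %% 4 != 1 %% 4)%N by lia.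
case: (boolP (odd (Q./2 + S./2))) => od; rewrite ?expr1 ?expr0 ?mulr1 ?mulrN1.
  rewrite oppr_le0 oppr_gt0 ler0n (lt_gtF (_ : 0 < 2)) ?ltr0n //; split; first by left.
  by split=> // -[_ h]; move: od; rewrite e h eqxx.
rewrite ltr0n; split; first by right.
by split=> // _; split=> //; apply/eqP; move: od; rewrite e negbK.
Qed.

End CycleVector.

(** * The bound p+ <= m + c and its equality case *)

Section UpperBound.

Variable C : numClosedFieldType.
Variable T : finType.
Implicit Types (G : mixedGraph T) (h : T -> T -> C).

(** Cycles range over all sequences; a finite search for an edge whose ends stay connected without
    it decides their existence. *)
Lemma is_cycle_dec G : (exists c, is_cycle G c) \/ (forall c, ~ is_cycle G c).
Proof.
have [/existsP[[a b] /andP[/= ab h]]|/existsPn h] := boolP [exists p : T * T,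
  adj G p.1 p.2 && connect (adj (del G [set [set p.1; p.2]])) p.1 p.2].
  by left; have [c [cc _]] := cycle_of_connect ab h; exists c.
right=> c cc; have [e ec] := cycle_edges_neq0 cc.
have /edgesP[a [b [ab eE]]] := subsetP (is_cycle_edges cc) _ ec.
by have := h (a, b); rewrite /= ab (connect_of_cycle_edge cc) // -eE.
Qed.

Lemma star_edges_lt G x y : adj G x y ->
  (#|edges (del G (star [set x]))| < #|edges G|)%N.
Proof.
move=> xy; apply: (@del_edges_lt _ _ _ [set x; y]); first by rewrite in_edges.
by rewrite in_star set11.
Qed.

Lemma cycle_head_adj G c x : is_cycle G c -> x \in c -> adj G x (next c x).
Proof. by case/and3P=> _ _; apply: next_cycle. Qed.

(** Stated for any Hermitian [h] supported on the edges, so that it also applies to -H(G), which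
    need not come from a mixed graph, and bounds p-. *)
Lemma pos_upper G h : herm h -> (forall x y, ~~ adj G x y -> h x y = 0) ->
  (pos h)%:Z <= (matching_number G)%:Z + cyclomatic G.
Proof.
have [n] := ubnP #|edges G|; elim: n G h => // n IH G h; rewrite ltnS => le hh h0.
have IHx x y : adj G x y -> (pos h)%:Z <=
    (matching_number (del G (star [set x])))%:Z + cyclomatic (del G (star [set x])) + 1.
  move=> xy; have := pos_isolate1_ge x hh.
  have := IH (del G (star [set x])) (isolate [set x] h) _ (herm_isolate _ hh) _.
  move=> /(_ (leq_trans (star_edges_lt xy) le)) H1 H2.
  have {}H1 := H1 _; suff: (pos (isolate [set x] h))%:Z <=
    (matching_number (del G (star [set x])))%:Z + cyclomatic (del G (star [set x])) by lia.
  apply: H1 => u v; rewrite adj_del_star /isolate => uv.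
  case: ifP => // /negbT; rewrite negb_or => /andP[ux vx].
  by apply: h0; move: uv; rewrite ux vx !andbT.
have [[c cc]|ac] := is_cycle_dec G.
  have [x xc] : exists x, x \in c by case: (c) cc => // x s _; exists x; rewrite mem_head.
  have := IHx _ _ (cycle_head_adj cc xc); have := cyclomatic_star_cycle cc xc.
  have := matching_number_sub (@del_sub _ G (star [set x])); lia.
have [e0|/set0Pn[e /edgesP[a [b [ab _]]]]] := eqVneq (edges G) set0.
  rewrite cyclomatic0 // addr0 pos0 // => x y; apply: h0.
  by rewrite -in_edges e0 inE.
have [u [v [uv pu]]] := acyclic_pendant ac ab.
have vu : adj G v u by rewrite adjC.
have := IHx _ _ vu; have := pendant_matching_number uv pu.
have := cyclomatic_sub (@del_sub _ G (star [set v])); lia.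
Qed.

Lemma pos_hentry_upper G :
  (pos (hentry G C))%:Z <= (matching_number G)%:Z + cyclomatic G.
Proof. by apply: pos_upper; [apply: hentry_herm|move=> x y; apply: hentry_eq0]. Qed.

Lemma pos_hentry_opp_upper G :
  (pos (fun x y => - hentry G C x y))%:Z <= (matching_number G)%:Z + cyclomatic G.
Proof.
apply: pos_upper; first exact/herm_opp/hentry_herm.
by move=> x y xy; rewrite hentry_eq0 ?oppr0.
Qed.

Lemma pos_hentry_star G (X : {set T}) :
  pos (hentry (del G (star X)) C) = pos (isolate X (hentry G C)).
Proof. exact/eq_pos/hentry_star. Qed.

Lemma pos_hentry_opp_star G (X : {set T}) :
  pos (fun x y => - hentry (del G (star X)) C x y) =
  pos (isolate X (fun x y => - hentry G C x y)).
Proof.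
by apply: eq_pos => x y; rewrite hentry_star /isolate; case: ifP; rewrite ?oppr0.
Qed.

Definition extremal G :=
  (pos (hentry G C))%:Z = (matching_number G)%:Z + cyclomatic G.

Lemma extremal_pos_eq G G' : extremal G -> extremal G' ->
    matching_number G = matching_number G' -> cyclomatic G = cyclomatic G' ->
  pos (hentry G C) = pos (hentry G' C).
Proof. by move=> e e' m c; apply/eqP; rewrite -eqz_nat e e' m c. Qed.

(** p+(G) <= p+(G - x) + 1 <= m(G - x) + c(G - x) + 1 <= m(G) + c(G), and extremality forces
    equality throughout. *)
Lemma extremal_star G c x : extremal G -> is_cycle G c -> x \in c ->
  let G' := del G (star [set x]) in
  [/\ extremal G', matching_number G' = matching_number G &
      cyclomatic G' = cyclomatic G - 1].
Proof.
move=> eG cc xc G'; have := pos_isolate1_ge x (@hentry_herm _ C G).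
rewrite -pos_hentry_star -/G' => H1; have H2 := pos_hentry_upper G'.
have H3 := cyclomatic_star_cycle cc xc; rewrite -/G' in H3.
have H4 := matching_number_sub (@del_sub _ G (star [set x])); rewrite -/G' in H4.
rewrite /extremal in eG *; split; lia.
Qed.

Lemma extremal_cycles_disjoint G : extremal G -> cycles_disjoint G.
Proof.
move=> eG; have diverge c1 c2 x : is_cycle G c1 -> is_cycle G c2 -> x \in c1 ->
    x \in c2 -> ~~ (cycle_edges c1 \subset cycle_edges c2) -> False.
  move=> cc1 cc2 x1 x2 ns; have /and3P[_ uc _] := cc1.
  have [y [y1 y2 ny]] := cycle_edges_diverge uc x1 x2 ns.
  have := cyclomatic_star_two_cycles cc1 cc2 y1 y2 ny.
  by have [_ _ ->] := extremal_star eG cc1 y1; lia.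
move=> c1 c2 cc1 cc2 ne x x1; apply/negP => x2.
have [s12|ns] := boolP (cycle_edges c1 \subset cycle_edges c2); last first.
  exact: diverge cc1 cc2 x1 x2 ns.
apply: (diverge c2 c1 x cc2 cc1 x2 x1); apply: contra ne => s21.
by rewrite eqEsubset s12.
Qed.

(* [cycle_vector] solves the equations on the cycle; what it leaves outside is
   a combination of rows of H(G - E(c)) that, the ranks being equal, are also
   combinations of the rows of the vertices off the cycle. *)
Lemma cycle_eigenvector G x0 s (c := x0 :: s) (G1 := del G (cycle_edges c))
    (G2 := del G1 (star [set x in c])) :
    is_cycle G c -> odd (size c) ->
    pos (hentry G1 C) = pos (hentry G2 C) ->
    pos (fun x y => - hentry G1 C x y) = pos (fun x y => - hentry G2 C x y) ->
  exists z : T -> C, z x0 = 1 /\ forall y, \sum_u z u * hentry G C u y =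
    ((-1) ^+ (size c)./2 * (cycle_weight C G x0 s + (cycle_weight C G x0 s)^*))
      * (y == x0)%:R.
Proof.
move=> cc oc e1 e2; pose h1 := hentry G1 C; pose cv := cycle_vector C G x0 s.
have hE u y : hentry G C u y = cycle_entry C G x0 s u y + h1 u y.
  by rewrite /cycle_entry /h1 hentry_del; case: ifP; rewrite ?addr0 ?add0r.
have /fin_all_exists[S hS] : forall a, exists s : T -> C,
    (forall x, x \in [set x in c] -> s x = 0) /\ forall y, \sum_x s x * h1 x y = h1 a y.
  apply: isolate_row_span; first exact: hentry_herm.
    by rewrite -pos_hentry_star -e1.
  transitivity (pos (fun x y => - hentry G2 C x y)); last exact/esym.
  by apply: eq_pos => x y; rewrite hentry_star.
have S0 a x : x \in c -> S a x = 0 by move=> xc; have [h _] := hS a; apply: h; rewrite inE.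
(* [S a] vanishes at the ends of every cycle edge, so it does not see the difference between H(G)
   and H(G1). *)
have Sh a y : \sum_x S a x * hentry G C x y = h1 a y.
  have [_ <-] := hS a; apply: eq_bigr => u _.
  have [uc|uc] := boolP (u \in c); first by rewrite S0 // !mul0r.
  rewrite hE /cycle_entry; case: ifP => [/cycle_edge_mem[uc' _ _]|_]; last by rewrite add0r.
  by rewrite uc' in uc.
exists (fun u => cv u - \sum_a cv a * S a u); split.
  rewrite /cv cycle_vector_head // big1 ?subr0 // => a _.
  by rewrite S0 ?mulr0 // mem_head.
move=> y; rewrite -cycle_vectorP //.
under eq_bigr => u _ do rewrite mulrBl.
rewrite sumrB; have -> : \sum_u (\sum_a cv a * S a u) * hentry G C u y = \sum_a cv a * h1 a y.
  under eq_bigr => u _ do rewrite mulr_suml.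
  rewrite exchange_big; apply: eq_bigr => a _; rewrite -Sh mulr_sumr.
  by apply: eq_bigr => u _; rewrite mulrA.
by rewrite -sumrB; apply: eq_bigr => u _; rewrite -mulrBr hE addrK.
Qed.

End UpperBound.

(** * Extremality is equivalent to the three conditions *)

Section Characterization.

Variable C : numClosedFieldType.
Variable T : finType.
Implicit Types (G : mixedGraph T) (h : T -> T -> C).

Definition good_cycle G (c : seq T) :=
  [/\ odd (size c), ~~ odd (signature G c) &
      (absz ((signature G c)%:Z - (size c)%:Z)%R = 1 %[mod 4])%N].

Definition good_cycles G := forall c : seq T, is_cycle G c -> good_cycle G c.

Lemma signature_del G D c : is_cycle (del G D) c -> signature (del G D) c = signature G c.
Proof.
move=> cc; have nD x : x \in c -> [set x; next c x] \notin D.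
  by move=> xc; rewrite (disjointFr (cycle_edges_disjoint_del cc)) // next_cycle_edge.
rewrite /signature; congr (absz (Posz _ - Posz _)); apply: eq_in_count => x xc /=.
  by rewrite /del_arc nD // andbT.
by rewrite /del_arc setUC nD // andbT.
Qed.

Lemma good_cycle_del G D c : is_cycle (del G D) c ->
  good_cycle (del G D) c <-> good_cycle G c.
Proof. by move=> cc; rewrite /good_cycle signature_del. Qed.

Lemma good_cycles_del G D : good_cycles G -> good_cycles (del G D).
Proof.
by move=> gG c cc; apply/good_cycle_del => //; apply/gG/(is_cycle_sub (@del_sub _ _ _) cc).
Qed.

Definition avoidable G := exists M, maximum_matching G M /\ avoids G M.

Lemma extremal_of_conditions G : cycles_disjoint G -> good_cycles G -> avoidable G ->
  extremal C G /\ pos (fun x y => - hentry G C x y) = matching_number G.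
Proof.
have [n] := ubnP #|edges G|; elim: n G => // n IH G; rewrite ltnS => le dG gG [M [MM av]].
have IHd (D : {set {set T}}) (e : {set T}) : e \in edges G -> e \in D ->
    (exists M, maximum_matching (del G D) M /\ avoids G M) ->
    extremal C (del G D) /\
    pos (fun x y => - hentry (del G D) C x y) = matching_number (del G D).
  move=> eG eD [M' [mM' av']]; apply: IH.
  - exact: leq_trans (del_edges_lt eG eD) le.
  - exact: cycles_disjoint_sub (@del_sub _ _ _) dG.
  - exact: good_cycles_del.
  - by exists M'; split=> //; apply: avoids_sub av'; apply: del_sub.
have hh : herm (hentry G C) := @hentry_herm _ _ _.
have hh' := herm_opp hh.
have U := pos_hentry_upper C G; have U' := pos_hentry_opp_upper C G.
have [[c cc]|ac] := is_cycle_dec G; last first.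
  rewrite cyclomatic_acyclic // addr0 in U U'.
  have [e0|/set0Pn[e /edgesP[a [b [ab _]]]]] := eqVneq (edges G) set0.
    have m0 : matching_number G = 0%N.
      have /andP[mM /eqP<-] := MM; apply/eqP; rewrite cards_eq0 -subset0 -e0.
      by have [] := matchingP _ _ mM.
    by rewrite /extremal cyclomatic_acyclic //; move: U U'; rewrite m0; lia.
  have [u [v [uv pu]]] := acyclic_pendant ac ab.
  have [M' mM'] := maximum_matching_ex (del G (star [set v])).
  have uvG : [set u; v] \in edges G by rewrite in_edges.
  have uvD : [set u; v] \in star [set v] by rewrite in_star set11 orbT.
  have [|eG' eN'] := IHd _ _ uvG uvD.
    by exists M'; split=> // f _ [c [x [y [cc _ _ _ _]]]]; apply: ac cc.
  have acd : forall c, ~ is_cycle (del G (star [set v])) c.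
    by move=> c /(is_cycle_sub (@del_sub _ _ _)); apply: ac.
  rewrite /extremal cyclomatic_acyclic // addr0 pos_hentry_star in eG'.
  rewrite pos_hentry_opp_star in eN'.
  have mle := star_matching_number G v.
  have uN : u != v := adj_neq uv.
  (* The row of the pendant [u] has a single nonzero entry, of modulus 1, at [v]; scaling by its
     conjugate gives the unit row at [v]. So p+ and p- both gain one from G - v to G while m gains
     at most one, and the upper bounds give equality. *)
  pose s w : C := if w == u then (hentry G C u v)^* else 0.
  have sv : s v = 0 by rewrite /s eq_sym (negPf uN).
  have sh y : \sum_w s w * hentry G C w y = (y == v)%:R.
    rewrite (bigD1 u) //= big1 ?addr0 => [|w wu]; last by rewrite /s (negPf wu) mul0r.
    rewrite /s eqxx; case: eqP => [->|/eqP yv]; first by rewrite mulrC hentry_unit.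
    by rewrite [hentry G C u y]hentry_eq0 ?mulr0 //; apply: contra yv => /pu->.
  have hvv : hentry G C v v = 0 by rewrite hentry_eq0 ?adj_irr.
  have p1 := pos_isolate1_isotropic hh sh sv hvv.
  have p2 : ((pos (isolate [set v] (fun x y => - hentry G C x y))).+1 <=
      pos (fun x y => - hentry G C x y)%R)%N.
    apply: (@pos_isolate1_isotropic _ _ _ _ (fun w => - s w)) => //.
    - by move=> y; rewrite -sh; apply: eq_bigr => w _; rewrite mulrNN.
    - by rewrite sv oppr0.
    - by rewrite hvv oppr0.
  by rewrite /extremal cyclomatic_acyclic //; split; lia.
have [oc _ _] := gG c cc.
have [m1 m2 mE] := maximum_matching_cut dG cc oc MM av.
case: c cc oc m1 m2 mE => // x0 s; set c := x0 :: s => cc oc m1 m2 mE.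
set G1 := del G (cycle_edges c) in m1 m2 mE; set G2 := del G1 _ in m2 mE.
have x0c : x0 \in c := mem_head _ _.
pose e0 := [set x0; next c x0].
have e0c : e0 \in cycle_edges c := next_cycle_edge x0c.
have e0G : e0 \in edges G by rewrite in_edges (cycle_head_adj cc).
have av0 : avoids G (M :\: cycle_edges c) by move=> e /setDP[eM _]; apply: av.
have [|x1 n1] := IHd _ _ e0G e0c; first by exists (M :\: cycle_edges c).
have [x2 n2] : extremal C G2 /\ pos (fun x y => - hentry G2 C x y) = matching_number G2.
  have s2 : subgraph G2 G by apply: sub_trans (@del_sub _ _ _) (@del_sub _ _ _).
  apply: IH.
  - apply: leq_trans le; apply: leq_ltn_trans (del_edges_lt e0G e0c).
    exact/subset_leq_card/sub_edges/del_sub.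
  - exact: cycles_disjoint_sub s2 dG.
  - exact/good_cycles_del/good_cycles_del.
  - by exists (M :\: cycle_edges c); split=> //; apply: avoids_sub av0.
have cE : cyclomatic G2 = cyclomatic G1 := cyclomatic_cut_cycle dG cc.
have [||z [zx zh]] := @cycle_eigenvector C T G x0 s cc oc.
- exact: extremal_pos_eq x1 x2 mE (esym cE).
- by rewrite -/G1 -/G2 n1 n2.
have [_ lP] := cycle_eigenvalue_gt0 C cc oc.
have {lP} [l [{}zh l0]] : exists l,
    (forall y, \sum_u z u * hentry G C u y = l * (y == x0)%:R) /\ 0 < l.
  by eexists; split; [exact: zh|apply/lP; have [] := gG c cc].
(* The same [z] serves H with value [l] and -H with value [- l]: when [x0] is restored, p+ gains one
   and p- does not grow. *)
have p1 := pos_isolate1_pos hh zh zx l0.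
have zh' y : \sum_u z u * - hentry G C u y = - l * (y == x0)%:R.
  by rewrite mulNr -zh -sumrN; apply: eq_bigr => u _; rewrite mulrN.
have l0' : - l <= 0 by rewrite oppr_le0 ltW.
have p2 := pos_isolate1_npos hh' zh' zx l0'.
have p3 := pos_isolate1_le x0 hh'.
(* A maximum matching can be moved off [x0]; this gives m(G - x0) = m(G) and makes the induction
   available for G - x0. *)
have [M' [mM' avM' M'x]] := maximum_matching_expose dG cc oc MM av x0c.
have [mM'' mE'] := maximum_matching_star mM' M'x.
have [||x3 n3] := IHd (star [set x0]) e0 e0G.
- by rewrite in_star set11.
- by exists M'.
rewrite /extremal pos_hentry_star mE' (cyclomatic_star_cycle_eq dG cc x0c) in x3.
rewrite pos_hentry_opp_star mE' in n3; move: x3 n3 p1 p2 p3 U; rewrite /extremal.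
move: (pos _) (pos _) (pos _) (pos _) => p p' r r'; clear; lia.
Qed.

Lemma conditions_of_extremal G : extremal C G ->
  [/\ cycles_disjoint G, good_cycles G & avoidable G].
Proof.
have [n] := ubnP #|edges G|; elim: n G => // n IH G; rewrite ltnS => le eG.
have dG := extremal_cycles_disjoint eG.
have IHx c x : is_cycle G c -> x \in c ->
    good_cycles (del G (star [set x])) /\ avoidable (del G (star [set x])).
  move=> cc xc; have [eG' _ _] := extremal_star eG cc xc.
  have [] := IH _ _ eG' => //.
  exact: leq_trans (star_edges_lt (cycle_head_adj cc xc)) le.
(* The matchings that the induction provides in G - a are maximum in G as well, since m does not
   drop. *)
have family c : is_cycle G c -> exists F : T -> {set {set T}}, forall a, a \in c ->
    [/\ maximum_matching G (F a), avoids (del G (star [set a])) (F a) &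
        forall e, e \in F a -> a \notin e].
  move=> cc; suff /fin_all_exists : forall a, exists M, a \in c ->
    [/\ maximum_matching G M, avoids (del G (star [set a])) M &
        forall e, e \in M -> a \notin e] by [].
  move=> a; case: (boolP (a \in c)) => [ac|_]; last by exists set0.
  have [_ [M [MM avM]]] := IHx c a cc ac; exists M => _.
  have [_ mE _] := extremal_star eG cc ac; have /andP[mM /eqP cM] := MM.
  have [mG hM] := matching_del_star mM; split=> //.
    by rewrite /maximum_matching mG cM mE eqxx.
  by move=> e eM; apply: hM eM (set11 a).
have exposing c x : is_cycle G c -> x \in c ->
    exists M, [/\ maximum_matching G M, avoids G M & forall e, e \in M -> x \notin e].
  by move=> cc xc; have [F hF] := family c cc; apply: (maximum_matching_glue dG cc hF xc).
split=> //; last first.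
  have [[c cc]|ac] := is_cycle_dec G; last first.
    have [M mM] := maximum_matching_ex G; exists M; split=> // e _ [c [x [y [cc _ _ _ _]]]].
    exact: ac cc.
  have [x xc] : exists x, x \in c by case: (c) cc => // x s _; exists x; rewrite mem_head.
  by have [M [mM avM _]] := exposing c x cc xc; exists M.
case=> // x0 s; set c := x0 :: s => cc.
have x0c : x0 \in c := mem_head _ _.
have [M [mM avM Mx]] := exposing c x0 cc x0c.
have oc := exposed_cycle_odd dG cc x0c mM avM Mx.
set G1 := del G (cycle_edges c).
have [[c' cc']|ac] := is_cycle_dec G1.
  have cG' := is_cycle_sub (@del_sub _ _ _) cc'.
  have [y yc'] : exists y, y \in c' by case: (c') cc' => // y t _; exists y; rewrite mem_head.
  have yc : y \notin c.
    apply/negP => yc; have E := cycles_disjoint_edges dG cc cG' yc yc'.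
    have := cycle_edges_disjoint_del cc'; rewrite E => /disjointFr dd.
    have [e ec] := cycle_edges_neq0 cG'; by have := dd _ ec; rewrite ec.
  have [gG' _] := IHx c' y cG' yc'.
  have ccy : is_cycle (del G (star [set y])) c.
    by apply: is_cycle_star => // x xc; rewrite inE; apply: contraNneq yc => <-.
  by have := gG' c ccy; rewrite good_cycle_del.
pose G2 := del G1 (star [set x in c]).
(* In a forest (i) and (ii) are vacuous and no edge leaves a cycle, so the converse applies and also
   yields p- = m. *)
have forest G' : subgraph G' G1 -> extremal C G' /\
    pos (fun x y => - hentry G' C x y) = matching_number G'.
  move=> s1; have ac' c' : ~ is_cycle G' c' by move/(is_cycle_sub s1); apply: ac.
  apply: extremal_of_conditions; try by move=> c' /ac'.
    by move=> c1 c2 /ac'.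
  have [M' mM'] := maximum_matching_ex G'; exists M'; split=> // e _ [c' [x [y [cc' _ _ _ _]]]].
  exact: ac' cc'.
have [x1 n1] : extremal C G1 /\ _ := forest G1 (fun x y => id).
have [x2 n2] : extremal C G2 /\ _ := forest G2 (@del_sub _ _ _).
have cE : cyclomatic G2 = cyclomatic G1 := cyclomatic_cut_cycle dG cc.
have [F hF] := family c cc.
have mE : matching_number G2 = matching_number G1.
  by apply: (cut_cycle_matching_number dG cc (F := F)) => a /hF[].
have [||z [zx zh]] := @cycle_eigenvector C T G x0 s cc oc.
- exact: extremal_pos_eq x1 x2 (esym mE) (esym cE).
- by rewrite -/G1 -/G2 n1 n2.
(* If [l <= 0], isolating [x0] does not lower p+, although m + c drops by one and both graphs are
   extremal. *)
have [[l0|lp] lP] := cycle_eigenvalue_gt0 C cc oc; last first.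
  by have [h1 h2] := lP.1 lp.
have := pos_isolate1_npos (@hentry_herm _ _ _) zh zx l0.
have [eG' mE' cE'] := extremal_star eG cc x0c.
move: eG eG'; rewrite /extremal pos_hentry_star mE' cE'; lia.
Qed.

End Characterization.

Theorem theorem3p10 (C : numClosedFieldType) (T : finType)
    (G : mixedGraph T) (hconn : connected_graph G) :
  (pos_inertia G C)%:Z = (matching_number G)%:Z + cyclomatic G
  <->
  [/\ cycles_disjoint G,
      (forall c : seq T, is_cycle G c ->
         [/\ odd (size c),
             ~~ odd (signature G c) &
             (absz ((signature G c)%:Z - (size c)%:Z)%R = 1 %[mod 4])%N]) &
      (exists M : {set {set T}}, maximum_matching G M /\
         forall e : {set T}, e \in M -> ~ leaves_cycle G e)].
Proof.
(* [pos_inertia G C] is convertible with [pos (hentry G C)], so the equation is [extremal C G]. *)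
split=> [/conditions_of_extremal //|[dG gG aG]].
exact: (extremal_of_conditions C dG gG aG).1.
Qed.
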